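(* Each dualizable shearlet system $\mathcal{SH}(\varphi_1,\psi_1;g)$ is compactly supported, i.e., every element $\psi^\ell_\lambda$ ($\lambda\in\Lambda_s$, $s\in\mathbb{S}$, $\ell\in\{0,1\}$) of it has compact support.
   Context: Fourier transform: $\hat f(\xi)=\int f(x)e^{-2\pi i\langle x,\xi\rangle}dx$. Generators. Fix $\rho\in(0,\frac{2}{13})$, $\alpha\ge\frac6\rho+1$, $\beta>\alpha+1$. Let $\varphi_1,\psi_1\in L^2(\mathbb{R})$ be compactly supported with $\inf_{\xi\in[-1/2,1/2]}|\hat\varphi_1(\xi)|>0$ and, up to multiplicative constants and for $\ell=0,1$, $$\Bigl|\bigl(\tfrac{d}{d\xi}\bigr)^\ell\hat\psi_1(\xi)\Bigr|\lesssim\frac{\min\{1,|\xi|^\alpha\}}{(1+|\xi|)^\beta},\qquad \Bigl|\bigl(\tfrac{d}{d\xi}\bigr)^\ell\hat\varphi_1(\xi)\Bigr|\lesssim\frac1{(1+|\xi|)^\beta},$$ and such that $\{\varphi_1(\cdot-m):m\in\mathbb{Z}\}\cup\{2^{j/2}\psi_1(2^j\cdot-m):j\ge0,m\in\mathbb{Z}\}$ is an orthonormal basis of $L^2(\mathbb{R})$. Let $g\in L^2(\mathbb{R}^2)$ be compactly supported with $\inf_{\xi\in\Omega_g}|\hat g(\xi)|>0$, where $\Omega_g=\{\xi\in\mathbb{R}^2:|\xi_2/\xi_1|<1,\ \frac12<|\xi_1|<1\}$, and $$\Bigl|\bigl(\tfrac{\partial}{\partial\xi_2}\bigr)^\ell\hat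 g(\xi)\Bigr|\lesssim\frac{\min\{1,|\xi_1|^\alpha\}}{(1+|\xi_1|)^\beta(1+|\xi_2|)^\beta},\quad\ell=0,1.$$ Matrices: $A_j=\mathrm{diag}(2^j,2^{\lfloor j/2\rfloor})$, $S_s=\begin{pmatrix}1&s\\0&1\end{pmatrix}$ for $s\in\mathbb{R}$, $D_p=\mathrm{diag}(1,2^{-\max\{p-1,0\}})$ for integers $p\ge0$; $R_{\pi/2}$ is the rotation of $\mathbb{R}^2$ by 90 degrees. Functions on $\mathbb{R}^2$: $\psi^0(x)=\psi_1(x_1)\varphi_1(x_2)$, $\varphi^0(x)=\varphi_1(x_1)\varphi_1(x_2)$, and for $p>0$, $\psi^p(x)=2^{(p-1)/2}\psi_1(x_1)\psi_1(2^{p-1}x_2)$, $\varphi^p(x)=2^{(p-1)/2}\varphi_1(x_1)\psi_1(2^{p-1}x_2)$. Shear parameters: $\mathbb{S}=\{0\}\cup\{q/2^i:i\ge0\text{ integer},\ q\text{ odd integer},\ |q|\le2^i\}$. For $s\in\mathbb{S}$, $j_0=j_0(s)$ is the smallest nonnegative integer such that $s=q_0/2^{\lceil j_0/2\rceil}$ for some integer $q_0$. Shearlet-type wavelets: $\varphi_{j,s,m,p}=|\det A_j|^{1/2}\varphi^p(A_jS_s\cdot-D_pm)$ and $\psi_{j,s,m,p}=|\det A_j|^{1/2}\psi^p(A_jS_s\cdot-D_pm)$, $m\in\mathbb{Z}^2$, $p\ge0$. Filters: $\hat G_0(\xi)=|\hat\varphi^0(\xi)|^2+\sum_{j=0}^\infty|\hat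 g(A_j^{-1}\xi)|^2$ and, for $s\in\mathbb{S}\setminus\{0\}$, $\hat G_s(\xi)=\sum_{j=j_0}^\infty|\hat g(A_j^{-1}S_s^{-T}\xi)|^2$; $G_s*h$ denotes the function with Fourier transform $\hat G_s\hat h$. Dualizable shearlet system: for $s\in\mathbb{S}$ with associated $j_0$, $\Lambda_s=\{(j,s,m,p):j\in\{-1\}\cup\{j_0,j_0+1,\dots\},\ m\in\mathbb{Z}^2,\ p\ge0\}$. For $\lambda=(-1,s,m,p)\in\Lambda_s$ set $\psi^0_\lambda=G_s*\varphi_{j_0,s,m,p}$; for $\lambda=(j,s,m,p)\in\Lambda_s$ with $j\ge j_0$ set $\psi^0_\lambda=G_s*\psi_{j,s,m,p}$; and $\psi^1_\lambda=\psi^0_\lambda\circ R_{\pi/2}$. Then $\mathcal{SH}(\varphi_1,\psi_1;g)=\{\psi^\ell_\lambda:\lambda\in\Lambda_s,\ s\in\mathbb{S},\ \ell=0,1\}$. *)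

(* Defs.v *)
From HB Require Import structures.
From mathcomp Require Import all_boot all_order all_algebra.
From mathcomp Require Import complex.
From mathcomp Require Import all_classical all_reals all_analysis.
Import Order.TTheory GRing.Theory Num.Theory.
Import numFieldNormedType.Exports ComplexField Normc.

Set Implicit Arguments.
Unset Strict Implicit.
Unset Printing Implicit Defensive.

Local Open Scope classical_set_scope.
Local Open Scope ring_scope.
Local Open Scope complex_scope.

Definition leb1 (R : realType) : {measure set (measurableTypeR R) -> \bar R} :=
  @lebesgue_measure R.

Definition leb2 (R : realType) :
    {measure set (measurableTypeR R * measurableTypeR R)%type -> \bar R} :=
  (@lebesgue_measure R \x @lebesgue_measure R)%E.

Section ComplexFunctions.
Context d (T : measurableType d) (R : realType).
Variable mu : {measure set T -> \bar R}.
Implicit Types f g : T -> R[i].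

Definition cintegral f : R[i] :=
  (\int[mu]_x complex.Re (f x)) +i* (\int[mu]_x complex.Im (f x)).

(* [Lfun mu p] includes (Borel) measurability; elements of L^p are handled
   through representatives. *)
Definition cLp (p : \bar R) f : Prop :=
  (@complex.Re R \o f) \in Lfun mu p /\ (@complex.Im R \o f) \in Lfun mu p.

Definition L2dist f g : \bar R :=
  Lnorm mu 2%:E (fun x => (normc (f x - g x))%:E).

Definition inner f g : R[i] := cintegral (fun x => f x * (g x)^*).

Definition orthonormal_basis (I : eqType) (e : I -> T -> R[i]) : Prop :=
  [/\ forall k, cLp 2%:E (e k),
      forall k l, inner (e k) (e l) = (k == l)%:R &
      forall f, cLp 2%:E f -> forall eps : R, 0 < eps ->
        exists c : seq (R[i] * I),
          (L2dist f (fun x => (\sum_(a <- c) a.1 * e a.2 x)%R) < eps%:E)%E].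

End ComplexFunctions.

(* Compact support of (the class of) a function: it vanishes almost
   everywhere outside some compact set. *)
Definition compactly_supported1 (R : realType) (f : R -> R[i]) : Prop :=
  exists K : set R, compact K /\ {ae leb1 R, forall x, ~ K x -> f x = 0}.

Definition compactly_supported2 (R : realType) (f : R * R -> R[i]) : Prop :=
  exists K : set (R * R),
    compact K /\ {ae leb2 R, forall x, ~ K x -> f x = 0}.

Section Fourier.
Variable R : realType.

Definition expi (t : R) : R[i] := cos t +i* sin t.

Definition dot (x y : R * R) : R := x.1 * y.1 + x.2 * y.2.

Definition fourier1 (f : R -> R[i]) (xi : R) : R[i] :=
  cintegral (leb1 R) (fun x => f x * expi (- (2 * pi * (x * xi)))).

Definition fourier2 (f : R * R -> R[i]) (xi : R * R) : R[i] :=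
  cintegral (leb2 R) (fun x => f x * expi (- (2 * pi * dot x xi))).

(* [F] is the Plancherel transform of [f]: the graph of the L^2 Fourier
   transform is the L^2-closure of the graph of [fourier2] on L^1 and L^2. *)
Definition is_fourier_L2 (f F : R * R -> R[i]) : Prop :=
  cLp (leb2 R) 2%:E f /\
  exists fn : nat -> R * R -> R[i],
    [/\ forall n, cLp (leb2 R) 1%:E (fn n) /\ cLp (leb2 R) 2%:E (fn n),
        L2dist (leb2 R) (fn n) f @[n --> \oo] --> 0%E &
        L2dist (leb2 R) (fourier2 (fn n)) F @[n --> \oo] --> 0%E].

(* [f] is (a representative of) the filtered function G * h, where the filter
   G is given by its Fourier transform [Ghat]. *)
Definition is_filtered (Ghat : R * R -> R) (h f : R * R -> R[i]) : Prop :=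
  is_fourier_L2 f (fun xi => (Ghat xi)%:C * fourier2 h xi).

(* Only applied to transforms of compactly supported L^2 functions, which are
   smooth, so [derive1n] is a genuine derivative there. *)
Definition cderiv (l : nat) (f : R -> R[i]) (x : R) : R[i] :=
  derive1n l (@complex.Re R \o f) x +i* derive1n l (@complex.Im R \o f) x.

Definition cpartial2 (l : nat) (f : R * R -> R[i]) (xi : R * R) : R[i] :=
  cderiv l (fun t => f (xi.1, t)) xi.2.

Definition bounded_upto_const (T : Type) (f : T -> R[i]) (b : T -> R) : Prop :=
  exists C : R, 0 < C /\ forall x, normc (f x) <= C * b x.

End Fourier.

Section Matrices.
Variable R : realType.

Definition mx22 (a b c d : R) : 'M[R]_2 :=
  \matrix_(i, j) (if i == 0 then if j == 0 then a else b
                  else if j == 0 then c else d).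

Definition mxact (M : 'M[R]_2) (x : R * R) : R * R :=
  (M 0 0 * x.1 + M 0 1 * x.2, M 1 0 * x.1 + M 1 1 * x.2).

Definition scaling (j : nat) : 'M[R]_2 := mx22 (2 ^+ j) 0 0 (2 ^+ j./2).

Definition shearing (s : R) : 'M[R]_2 := mx22 1 s 0 1.

(* the truncated predecessor [p.-1] is max {p - 1, 0} *)
Definition sampling (p : nat) : 'M[R]_2 := mx22 1 0 0 (2 ^- p.-1).

Definition rot90 : 'M[R]_2 := mx22 0 (-1) 1 0.

End Matrices.

Arguments scaling {R} j.
Arguments sampling {R} p.
Arguments rot90 {R}.

Section Shearlets.
Variable R : realType.
Variables (phi1 psi1 : R -> R[i]) (g : R * R -> R[i]).

Definition wavelet_family (k : (int + nat * int)%type) : R -> R[i] :=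
  match k with
  | inl m => fun x => phi1 (x - m%:~R)
  | inr (j, m) =>
      fun x => (2 `^ (j%:R / 2))%:C * psi1 (2 ^+ j * x - m%:~R)
  end.

Definition Omega_g : set (R * R) :=
  [set xi | `|xi.2 / xi.1| < 1 /\ 2^-1 < `|xi.1| < 1].

Definition psi_gen (p : nat) (x : R * R) : R[i] :=
  if p is q.+1
  then (2 `^ (q%:R / 2))%:C * (psi1 x.1 * psi1 (2 ^+ q * x.2))
  else psi1 x.1 * phi1 x.2.

Definition phi_gen (p : nat) (x : R * R) : R[i] :=
  if p is q.+1
  then (2 `^ (q%:R / 2))%:C * (phi1 x.1 * psi1 (2 ^+ q * x.2))
  else phi1 x.1 * phi1 x.2.

Definition shears : set R :=
  [set s | s = 0 \/
     exists (i : nat) (q : int),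
       [/\ odd `|q|%N, `|q| <= 2 ^+ i & s = q%:~R / 2 ^+ i]].

Definition shear_at_level (s : R) (j : nat) : Prop :=
  exists q : int, s = q%:~R / 2 ^+ uphalf j.

(* the default value 0 is irrelevant for s in [shears] *)
Definition shear_j0 (s : R) : nat :=
  xget 0%N [set j | shear_at_level s j /\
                    forall k, shear_at_level s k -> (j <= k)%N].

Definition sheared (f : nat -> R * R -> R[i])
    (j : nat) (s : R) (m : int * int) (p : nat) (x : R * R) : R[i] :=
  (Num.sqrt `|\det (@scaling R j)|)%:C *
  f p (mxact (scaling j *m shearing s) x -
       mxact (sampling p) (m.1%:~R, m.2%:~R)).

(* The series has nonnegative terms; under the decay assumption on the
   Fourier transform of [g] it converges, so [fine] discards nothing. *)
Definition filter_hat (s : R) (xi : R * R) : R :=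
  if s == 0 then
    normc (fourier2 (phi_gen 0) xi) ^+ 2 +
    fine (\sum_(0 <= j <oo)
      (normc (fourier2 g (mxact (invmx (scaling j)) xi)) ^+ 2)%:E)%E
  else
    fine (\sum_(shear_j0 s <= j <oo)
      (normc (fourier2 g
         (mxact (invmx (scaling j) *m (invmx (shearing s))^T) xi)) ^+ 2)%:E)%E.

Definition shearlet_index : Type := (int * R * (int * int) * nat)%type.

Definition Lambda (s : R) : set shearlet_index :=
  [set lam | exists (j : int) (m : int * int) (p : nat),
     lam = (j, s, m, p) /\ (j = -1 \/ (shear_j0 s)%:Z <= j)].

(* the negative scale (only j = -1 occurs in [Lambda]) is the coarse one *)
Definition unfiltered (lam : shearlet_index) : R * R -> R[i] :=
  let: (j, s, m, p) := lam in
  match j with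
  | Posz n => sheared psi_gen n s m p
  | Negz _ => sheared phi_gen (shear_j0 s) s m p
  end.

Definition is_psi0 (lam : shearlet_index) (f : R * R -> R[i]) : Prop :=
  let: (_, s, _, _) := lam in is_filtered (filter_hat s) (unfiltered lam) f.

Definition is_psi (l : bool) (lam : shearlet_index) (f : R * R -> R[i]) : Prop :=
  if l then exists2 f0, is_psi0 lam f0 & f = f0 \o mxact rot90
  else is_psi0 lam f.

(* All representatives of all elements of the dualizable shearlet system. *)
Definition shearlet_system : set (R * R -> R[i]) :=
  [set f | exists s lam l, [/\ shears s, Lambda s lam & is_psi l lam f]].

End Shearlets.

Arguments Omega_g {R}.

(* Main.v *)
Require Import Defs.
From HB Require Import structures.
From mathcomp Require Import all_boot all_order all_algebra.
From mathcomp Require Import complex.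
From mathcomp Require Import all_classical all_reals all_analysis.
From mathcomp Require Import measurable_realfun.
From mathcomp Require Import ring lra.
Import Order.TTheory GRing.Theory Num.Theory.
Import numFieldNormedType.Exports ComplexField Normc.

Local Open Scope classical_set_scope.
Local Open Scope ring_scope.
Local Open Scope complex_scope.

(** Each summand of a filter is a squared modulus, hence the Fourier transform
    of a compactly supported function convolved with its reflected conjugate;
    this function is the low-pass generator, or [g] dilated and sheared. The
    dilations contract, so all these convolutions live in one box, and every
    partial sum of the filter turns an unfiltered shearlet, which is a tensor
    product of compactly supported generators along two affine forms, into a
    function supported in one fixed box. The decay of the transform of
    [g] makes the series converge pointwise, and the filtered shearlet inherits
    the box.

    The passage to the limit is carried out by duality. Call a function of the
    frequency variable an annihilator of a box if it is integrable and its
    Fourier transform vanishes on the box. Multiplying an annihilator by the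
    transform of a compactly supported function shrinks the box by the size of
    the support ([annihilator_mul]); this is the convolution argument, seen from
    the side of the test function. An annihilator of a large box therefore pairs
    to zero with the partial filters times the transform of the unfiltered
    shearlet, and by dominated convergence with the full product
    ([filter_pairing_eq0]). The multiplication formula along a sequence that
    defines the Plancherel transform moves the Fourier transform onto the test
    function ([fourier_L2_orthogonal]): the filtered shearlet is orthogonal to
    the transforms of all annihilators.

    There are enough annihilators because the integral of
    [(1 - cos (b * x)) / x ^+ 2] is proportional to the absolute value of [b]
    ([Rintegral_cosine_kernel]): combinations of these kernels have
    trapezoids as Fourier transforms ([trapezoid_spectrum_transform]). Products
    of two trapezoids approximate the indicators of rectangles, and a locally
    integrable function whose integral vanishes over all rectangles that avoid a
    box vanishes almost everywhere outside the box ([ae_off_box]). *)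

(** * Complex scalars and complex integrals *)

Section ComplexScalars.
Context {R : realType}.
Implicit Types z w : R[i].

Lemma ReD z w : complex.Re (z + w) = complex.Re z + complex.Re w.
Proof. by case: z; case: w. Qed.

Lemma ImD z w : complex.Im (z + w) = complex.Im z + complex.Im w.
Proof. by case: z; case: w. Qed.

Lemma ReB z w : complex.Re (z - w) = complex.Re z - complex.Re w.
Proof. by case: z; case: w. Qed.

Lemma ImB z w : complex.Im (z - w) = complex.Im z - complex.Im w.
Proof. by case: z; case: w. Qed.

Lemma ReM z w : complex.Re (z * w) =
  complex.Re z * complex.Re w - complex.Im z * complex.Im w.
Proof. by case: z; case: w. Qed.

Lemma ImM z w : complex.Im (z * w) =
  complex.Re z * complex.Im w + complex.Im z * complex.Re w.
Proof. by case: z; case: w. Qed.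

Lemma complex_eq z w : complex.Re z = complex.Re w ->
  complex.Im z = complex.Im w -> z = w.
Proof. by case: z => a b; case: w => c d /= -> ->. Qed.

Lemma normc_ge0 z : 0 <= normc z.
Proof. by case: z => a b; rewrite /normc sqrtr_ge0. Qed.

Lemma normcE_ReIm z :
  normc z = Num.sqrt (complex.Re z ^+ 2 + complex.Im z ^+ 2).
Proof. by case: z. Qed.

Lemma normr_Re_le z : `|complex.Re z| <= normc z.
Proof.
by rewrite normcE_ReIm -sqrtr_sqr ler_sqrt ?addr_ge0 ?sqr_ge0// lerDl sqr_ge0.
Qed.

Lemma normr_Im_le z : `|complex.Im z| <= normc z.
Proof.
by rewrite normcE_ReIm -sqrtr_sqr ler_sqrt ?addr_ge0 ?sqr_ge0// lerDr sqr_ge0.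
Qed.

Lemma normc_le z : normc z <= `|complex.Re z| + `|complex.Im z|.
Proof.
rewrite normcE_ReIm -[leRHS]ger0_norm ?addr_ge0// -sqrtr_sqr.
rewrite ler_sqrt ?sqr_ge0// sqrrD !real_normK ?num_real//.
have := mulr_ge0 (normr_ge0 (complex.Re z)) (normr_ge0 (complex.Im z)).
lra.
Qed.

Lemma normc_realC (x : R) : normc x%:C = `|x|.
Proof. by rewrite /= expr0n addr0 sqrtr_sqr. Qed.

Lemma sqr_normcE z : ((normc z) ^+ 2)%:C = z * z^*.
Proof.
case: z => a b; rewrite /= sqr_sqrtr ?addr_ge0 ?sqr_ge0//.
by apply: complex_eq; rewrite ?ReM ?ImM /=; ring.
Qed.

Lemma normc_conj z : normc z^* = normc z.
Proof. by case: z => a b; rewrite /= sqrrN. Qed.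

Lemma normc_expi (t : R) : normc (expi t) = 1.
Proof. by rewrite /expi /= cos2Dsin2 sqrtr1. Qed.

Lemma expiD (s t : R) : expi (s + t) = expi s * expi t.
Proof.
by apply: complex_eq; rewrite ?ReM ?ImM /= ?cosD ?sinD//; ring.
Qed.

Lemma expi0 : expi (0 : R) = 1.
Proof. by rewrite /expi cos0 sin0. Qed.

Lemma conj_expi (t : R) : (expi t)^* = expi (- t).
Proof. by rewrite /expi /= cosN sinN. Qed.

End ComplexScalars.

Section ComplexIntegration.
Context {d} {T : measurableType d} {R : realType}.
Variable mu : {measure set T -> \bar R}.
Implicit Types f g : T -> R[i].

Definition cmeasurable f : Prop :=
  measurable_fun setT (@complex.Re R \o f) /\
  measurable_fun setT (@complex.Im R \o f).

Definition cintegrable f : Prop :=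
  mu.-integrable setT (EFin \o (@complex.Re R \o f)) /\
  mu.-integrable setT (EFin \o (@complex.Im R \o f)).

Lemma cmeasurable_cst (c : R[i]) : cmeasurable (fun=> c).
Proof. by split; apply: measurable_cst. Qed.

Lemma cmeasurableD f g : cmeasurable f -> cmeasurable g ->
  cmeasurable (fun x => f x + g x).
Proof.
move=> [rf jf] [rg jg]; split.
  rewrite [X in measurable_fun _ X](_ : _ =
    (complex.Re (R:=R) \o f) \+ (complex.Re (R:=R) \o g)).
    exact: measurable_funD.
  by apply/funext => x /=; rewrite ReD.
rewrite [X in measurable_fun _ X](_ : _ =
  (complex.Im (R:=R) \o f) \+ (complex.Im (R:=R) \o g)).
  exact: measurable_funD.
by apply/funext => x /=; rewrite ImD.
Qed.

Lemma cmeasurableB f g : cmeasurable f -> cmeasurable g ->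
  cmeasurable (fun x => f x - g x).
Proof.
move=> [rf jf] [rg jg]; split.
  rewrite [X in measurable_fun _ X](_ : _ =
    (complex.Re (R:=R) \o f) \- (complex.Re (R:=R) \o g)).
    exact: measurable_funB.
  by apply/funext => x /=; rewrite ReB.
rewrite [X in measurable_fun _ X](_ : _ =
  (complex.Im (R:=R) \o f) \- (complex.Im (R:=R) \o g)).
  exact: measurable_funB.
by apply/funext => x /=; rewrite ImB.
Qed.

Lemma cmeasurableM f g : cmeasurable f -> cmeasurable g ->
  cmeasurable (fun x => f x * g x).
Proof.
move=> [rf jf] [rg jg]; split.
  rewrite [X in measurable_fun _ X](_ : _ =
    ((complex.Re (R:=R) \o f) \* (complex.Re (R:=R) \o g)) \-
    ((complex.Im (R:=R) \o f) \* (complex.Im (R:=R) \o g))).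
    by apply: measurable_funB; apply: measurable_funM.
  by apply/funext => x /=; rewrite ReM.
rewrite [X in measurable_fun _ X](_ : _ =
    ((complex.Re (R:=R) \o f) \* (complex.Im (R:=R) \o g)) \+
    ((complex.Im (R:=R) \o f) \* (complex.Re (R:=R) \o g))).
  by apply: measurable_funD; apply: measurable_funM.
by apply/funext => x /=; rewrite ImM.
Qed.

Lemma cmeasurable_conj f : cmeasurable f -> cmeasurable (fun x => (f x)^*).
Proof.
move=> [rf jf]; split.
  by rewrite (_ : _ \o _ = complex.Re (R:=R) \o f)//;
    apply/funext => x /=; case: (f x).
rewrite (_ : _ \o _ = (fun x => - (complex.Im (R:=R) \o f) x)).
  exact: measurable_funN.
by apply/funext => x /=; case: (f x).
Qed.

Lemma cmeasurable_real (h : T -> R) : measurable_fun setT h ->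
  cmeasurable (fun x => (h x)%:C).
Proof. by move=> mh; split => //; exact: measurable_cst. Qed.

Lemma measurable_normc f : cmeasurable f ->
  measurable_fun setT (fun x => normc (f x)).
Proof.
move=> [rf jf].
rewrite (_ : (fun _ => _) = (@Num.sqrt R) \o
   (fun x => (complex.Re (R:=R) \o f) x ^+ 2 + (complex.Im (R:=R) \o f) x ^+ 2)).
  apply: measurableT_comp.
    by apply: continuous_measurable_fun; exact: sqrt_continuous.
  by apply: measurable_funD; apply: measurable_funX.
by apply/funext => x /=; rewrite normcE_ReIm.
Qed.

Lemma cintegrable_measurable f : cintegrable f -> cmeasurable f.
Proof.
by move=> [/measurable_int/measurable_EFinP ? /measurable_int/measurable_EFinP ?].
Qed.

Lemma cintegrable_norm f : cintegrable f ->
  mu.-integrable setT (EFin \o (fun x => normc (f x))).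
Proof.
move=> fi; have [ri ji] := fi.
have [mr mj] := cintegrable_measurable _ fi.
apply: (@le_integrable _ _ _ mu _ measurableT _
  (fun x => `|(EFin \o (complex.Re (R:=R) \o f)) x| +
            `|(EFin \o (complex.Im (R:=R) \o f)) x|)%E) => //.
- by apply/measurable_EFinP/measurable_normc; split.
- move=> x _ /=; rewrite lee_fin [leRHS]ger0_norm ?addr_ge0//.
  by rewrite ger0_norm ?normc_ge0// normc_le.
- by apply: integrableD => //; exact: integrable_abse.
Qed.

Lemma cintegrable_le f (g : T -> R) : cmeasurable f ->
  mu.-integrable setT (EFin \o g) -> (forall x, normc (f x) <= g x) ->
  cintegrable f.
Proof.
move=> [mr mj] gi fg.
have g0 x : 0 <= g x by apply: le_trans (fg x); exact: normc_ge0.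
split; apply: (@le_integrable _ _ _ mu _ measurableT _ (EFin \o g)) => //.
- exact/measurable_EFinP.
- move=> x _ /=; rewrite lee_fin (ger0_norm (g0 x)).
  exact: le_trans (normr_Re_le _) (fg x).
- exact/measurable_EFinP.
- move=> x _ /=; rewrite lee_fin (ger0_norm (g0 x)).
  exact: le_trans (normr_Im_le _) (fg x).
Qed.

Lemma cintegrable_bounded f g (C : R) : cintegrable f -> cmeasurable g ->
  (forall x, normc (g x) <= C) -> cintegrable (fun x => f x * g x).
Proof.
move=> fi mg gC.
apply: (@cintegrable_le _ (fun x => C * normc (f x))).
- by apply: cmeasurableM => //; exact: cintegrable_measurable.
- rewrite (_ : _ \o _ = (fun x => C%:E * (EFin \o (fun x => normc (f x))) x)%E)//.
  by apply: integrableZl => //; exact: cintegrable_norm.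
- by move=> x; rewrite normcM mulrC ler_wpM2r ?normc_ge0.
Qed.

Lemma cintegrableD f g : cintegrable f -> cintegrable g ->
  cintegrable (fun x => f x + g x).
Proof.
move=> fi gi; apply: (@cintegrable_le _ (fun x => normc (f x) + normc (g x))).
- by apply: cmeasurableD; exact: cintegrable_measurable.
- have := integrableD measurableT (cintegrable_norm _ fi) (cintegrable_norm _ gi).
  exact.
- by move=> x; exact: le_normcD.
Qed.

Lemma cintegrableB f g : cintegrable f -> cintegrable g ->
  cintegrable (fun x => f x - g x).
Proof.
move=> fi gi; apply: (@cintegrable_le _ (fun x => normc (f x) + normc (g x))).
- by apply: cmeasurableB; exact: cintegrable_measurable.
- have := integrableD measurableT (cintegrable_norm _ fi) (cintegrable_norm _ gi).
  exact.
- by move=> x; rewrite -(normcN (g x)); exact: le_normcD.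
Qed.

Lemma eq_cintegral f g : f =1 g -> cintegral mu f = cintegral mu g.
Proof. by move=> /funext ->. Qed.

Lemma cintegralZl (c : R[i]) f : cintegrable f ->
  cintegral mu (fun x => c * f x) = c * cintegral mu f.
Proof.
move=> [ri ji]; apply: complex_eq; rewrite /= ?ReM ?ImM /cintegral /=.
  under eq_Rintegral do rewrite ReM.
  rewrite RintegralB//; first by rewrite !RintegralZl.
    exact: (integrableZl measurableT _ ri).
  exact: (integrableZl measurableT _ ji).
under eq_Rintegral do rewrite ImM.
rewrite RintegralD//; first by rewrite !RintegralZl.
  exact: (integrableZl measurableT _ ji).
exact: (integrableZl measurableT _ ri).
Qed.

Lemma cintegralD f g : cintegrable f -> cintegrable g ->
  cintegral mu (fun x => f x + g x) = cintegral mu f + cintegral mu g.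
Proof.
move=> [rf jf] [rg jg]; apply: complex_eq; rewrite ?ReD ?ImD /cintegral /=.
  by under eq_Rintegral do rewrite ReD; rewrite RintegralD.
by under eq_Rintegral do rewrite ImD; rewrite RintegralD.
Qed.

Lemma cintegralB f g : cintegrable f -> cintegrable g ->
  cintegral mu (fun x => f x - g x) = cintegral mu f - cintegral mu g.
Proof.
move=> [rf jf] [rg jg]; apply: complex_eq; rewrite ?ReB ?ImB /cintegral /=.
  by under eq_Rintegral do rewrite ReB; rewrite RintegralB.
by under eq_Rintegral do rewrite ImB; rewrite RintegralB.
Qed.

Lemma cintegral0 : cintegral mu (fun=> 0) = 0.
Proof.
by apply: complex_eq; rewrite /cintegral /= /Rintegral integral0_eq.
Qed.

Lemma cintegral_conj f : cintegrable f ->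
  cintegral mu (fun x => (f x)^*) = (cintegral mu f)^*.
Proof.
move=> [rf jf]; apply: complex_eq; rewrite /cintegral /=.
  by apply: eq_Rintegral => x _; case: (f x).
rewrite -[RHS]mulN1r -RintegralZl//.
by apply: eq_Rintegral => x _; case: (f x) => a b /=; rewrite mulN1r.
Qed.

Lemma cintegrable_conj f : cintegrable f -> cintegrable (fun x => (f x)^*).
Proof.
move=> fi; apply: (@cintegrable_le _ (fun x => normc (f x))).
- by apply: cmeasurable_conj; exact: cintegrable_measurable.
- exact: cintegrable_norm.
- by move=> x; rewrite normc_conj.
Qed.

Lemma normc_cintegral_le f : cintegrable f ->
  normc (cintegral mu f) <= 2 * \int[mu]_x normc (f x).
Proof.
move=> fi; have [rf jf] := fi.
have ni := cintegrable_norm _ fi.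
have H (h : T -> R) : mu.-integrable setT (EFin \o h) ->
   (forall x, `|h x| <= normc (f x)) -> `|\int[mu]_x h x| <= \int[mu]_x normc (f x).
  move=> hi hf; apply: le_trans (le_normr_Rintegral measurableT hi) _.
  apply: le_Rintegral => //; exact: integrable_norm.
apply: le_trans (normc_le _) _; rewrite /cintegral /=.
have := H _ rf (fun x => normr_Re_le (f x)).
have := H _ jf (fun x => normr_Im_le (f x)).
rewrite /=; lra.
Qed.

Lemma cintegral_ae0 f : cmeasurable f -> {ae mu, forall x, f x = 0} ->
  cintegral mu f = 0.
Proof.
move=> [rf jf] f0; apply: complex_eq; rewrite /cintegral /= /Rintegral.
  rewrite (@ae_eq_integral _ _ _ mu setT (cst 0%E)) ?integral0//.
    exact/measurable_EFinP.
  by apply: filterS f0 => x fx _ /=; rewrite fx.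
rewrite (@ae_eq_integral _ _ _ mu setT (cst 0%E)) ?integral0//.
  exact/measurable_EFinP.
by apply: filterS f0 => x fx _ /=; rewrite fx.
Qed.

End ComplexIntegration.

(** * Exchange of complex integrals *)

Section ComplexFubini.
Context {d1 d2} {T1 : measurableType d1} {T2 : measurableType d2}.
Context {R : realType}.
Variables (m1 : {sigma_finite_measure set T1 -> \bar R})
          (m2 : {sigma_finite_measure set T2 -> \bar R}).

Lemma Rintegral12_prod (F : T1 * T2 -> R) :
  (m1 \x m2)%E.-integrable setT (EFin \o F) ->
  \int[m1]_x (\int[m2]_y F (x, y)) = \int[(m1 \x m2)%E]_z F z.
Proof.
move=> iF; rewrite /Rintegral -(integral12_prod_meas1 iF); congr fine.
have mF := measurable_fubini_F iF.
apply: ae_eq_integral => //.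
  apply/measurable_EFinP; apply: measurableT_comp mF; exact: fine_measurable.
apply: filterS (ae_integrable1 iF) => x ix _.
by rewrite /= fineK//; apply: integrable_fin_num.
Qed.

Lemma Rintegral21_prod (F : T1 * T2 -> R) :
  (m1 \x m2)%E.-integrable setT (EFin \o F) ->
  \int[m2]_y (\int[m1]_x F (x, y)) = \int[(m1 \x m2)%E]_z F z.
Proof.
move=> iF; rewrite /Rintegral -(integral21_prod_meas1 iF); congr fine.
have mF := measurable_fubini_G iF.
apply: ae_eq_integral => //.
  apply/measurable_EFinP; apply: measurableT_comp mF; exact: fine_measurable.
apply: filterS (ae_integrable2 iF) => x ix _.
by rewrite /= fineK//; apply: integrable_fin_num.
Qed.

Lemma cintegral12_prod (F : T1 * T2 -> R[i]) : cintegrable (m1 \x m2)%E F ->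
  cintegral m1 (fun x => cintegral m2 (fun y => F (x, y))) =
  cintegral (m1 \x m2)%E F.
Proof.
move=> [ri ji]; apply: complex_eq; rewrite /cintegral /=.
  exact: Rintegral12_prod.
exact: (Rintegral12_prod _ ji).
Qed.

Lemma cintegral21_prod (F : T1 * T2 -> R[i]) : cintegrable (m1 \x m2)%E F ->
  cintegral m2 (fun y => cintegral m1 (fun x => F (x, y))) =
  cintegral (m1 \x m2)%E F.
Proof.
move=> [ri ji]; apply: complex_eq; rewrite /cintegral /=.
  exact: Rintegral21_prod.
exact: (Rintegral21_prod _ ji).
Qed.

Lemma cmeasurable_comp {d d'} {X : measurableType d} {Y : measurableType d'}
    (h : X -> Y) (f : Y -> R[i]) :
  measurable_fun setT h -> cmeasurable f -> cmeasurable (f \o h).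
Proof.
by move=> mh [rf jf]; split; rewrite compA; apply: measurableT_comp.
Qed.

Lemma integrable_tensor (k : T1 -> R) (phi : T2 -> R) :
  m1.-integrable setT (EFin \o k) -> m2.-integrable setT (EFin \o phi) ->
  (m1 \x m2)%E.-integrable setT (EFin \o (fun z => k z.1 * phi z.2)).
Proof.
move=> ik ip.
have mk := measurable_int _ ik; have mp := measurable_int _ ip.
apply/integrable12ltyP.
  apply/measurable_EFinP; apply: measurable_funM.
    by apply: measurableT_comp => //; exact/measurable_EFinP.
  by apply: measurableT_comp => //; exact/measurable_EFinP.
rewrite (_ : (\int[m1]_x _)%E =
  (\int[m1]_x (`|(k x)%:E| * \int[m2]_y `|(phi y)%:E|))%E); last first.
  apply: eq_integral => x _; rewrite -ge0_integralZl//=.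
    by apply: eq_integral => y _; rewrite -EFinM normrM.
  exact: (measurableT_comp (@abse_measurable _ _) mp).
rewrite ge0_integralZr//; last 2 first.
- exact: (measurableT_comp (@abse_measurable _ _) mk).
- exact: integral_ge0.
move/integrableP : ik => [_ ik]; move/integrableP : ip => [_ ip].
by apply: lte_mul_pinfty => //; rewrite ?integral_ge0// ge0_fin_numE ?integral_ge0.
Qed.

Lemma cintegrable_tensor (k : T1 -> R[i]) (phi : T2 -> R[i]) :
  cintegrable m1 k -> cintegrable m2 phi ->
  cintegrable (m1 \x m2)%E (fun z => k z.1 * phi z.2).
Proof.
move=> ik ip.
apply: (@cintegrable_le _ _ _ _ _ (fun z => normc (k z.1) * normc (phi z.2))).
- apply: cmeasurableM; apply: cmeasurable_comp => //.
    exact: cintegrable_measurable ik.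
  exact: cintegrable_measurable ip.
- apply: (integrable_tensor (fun x => normc (k x)) (fun x => normc (phi x))).
    exact: cintegrable_norm ik.
  exact: cintegrable_norm ip.
- by move=> z; rewrite normcM.
Qed.

Lemma cintegral_tensor (k : T1 -> R[i]) (phi : T2 -> R[i]) :
  cintegrable m1 k -> cintegrable m2 phi ->
  cintegral (m1 \x m2)%E (fun z => k z.1 * phi z.2) =
  cintegral m1 k * cintegral m2 phi.
Proof.
move=> ik ip; rewrite -cintegral12_prod /=; last exact: cintegrable_tensor.
rewrite mulrC -cintegralZl//; apply: eq_cintegral => x.
by rewrite cintegralZl// mulrC.
Qed.

(** The Fourier multiplication formulas are instances of this exchange, with a
    character or a product of two characters as the bounded kernel [E]. *)
Lemma cintegral_exchange (k : T1 -> R[i]) (phi : T2 -> R[i])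
    (E : T1 * T2 -> R[i]) (C : R) :
  cintegrable m1 k -> cintegrable m2 phi -> cmeasurable E ->
  (forall z, normc (E z) <= C) ->
  cintegral m2 (fun y => phi y * cintegral m1 (fun x => k x * E (x, y))) =
  cintegral m1 (fun x => k x * cintegral m2 (fun y => phi y * E (x, y))).
Proof.
move=> ik ip mE EC.
have iH : cintegrable (m1 \x m2)%E (fun z => k z.1 * phi z.2 * E z).
  exact: cintegrable_bounded (cintegrable_tensor _ _ ik ip) mE EC.
transitivity (cintegral (m1 \x m2)%E (fun z => k z.1 * phi z.2 * E z)).
  rewrite -cintegral21_prod//; apply: eq_cintegral => y /=.
  rewrite -cintegralZl.
    by apply: eq_cintegral => x; rewrite mulrA (mulrC (phi y)).
  apply: (cintegrable_bounded _ _ _ _ ik) => //.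
    exact: (cmeasurable_comp (fun x => (x, y)) _ (pair2_measurable y) mE).
rewrite -cintegral12_prod//; apply: eq_cintegral => x /=.
rewrite -cintegralZl.
  by apply: eq_cintegral => y; rewrite mulrA.
apply: (cintegrable_bounded _ _ _ _ ip) => //.
  exact: (cmeasurable_comp (fun y => (x, y)) _ (pair1_measurable x) mE).
Qed.

Lemma measurable_Rintegral1 (F : T1 * T2 -> R) : measurable_fun setT F ->
  measurable_fun setT (fun y => \int[m1]_x F (x, y)).
Proof.
move=> mF.
have mF' : measurable_fun setT (EFin \o F) by exact/measurable_EFinP.
have mI : measurable_fun setT (fun y => (\int[m1]_x (EFin \o F) (x, y))%E).
  rewrite (_ : (fun _ => _) = (fun y =>
    fubini_G m1 (EFin \o F)^\+ y - fubini_G m1 (EFin \o F)^\- y)%E).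
    apply: emeasurable_funB; apply: measurable_fun_fubini_tonelli_G => //.
      exact: measurable_funepos.
    exact: measurable_funeneg.
  apply/funext => y; rewrite integralE /fubini_G; congr (_ - _)%E.
    by apply: eq_integral => x _; rewrite !funeposE.
  by apply: eq_integral => x _; rewrite !funenegE.
rewrite /Rintegral; apply: measurableT_comp mI; exact: fine_measurable.
Qed.

Lemma cmeasurable_cintegral (F : T1 * T2 -> R[i]) : cmeasurable F ->
  cmeasurable (fun y => cintegral m1 (fun x => F (x, y))).
Proof.
by move=> [rF jF]; split; apply: (measurable_Rintegral1 (_ \o F)).
Qed.

End ComplexFubini.

(** * Fourier transforms on the plane and annihilators of a box *)

Notation plane R := (measurableTypeR R * measurableTypeR R)%type.
Notation pmeasurable := (@cmeasurable _ (plane _) _).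

(** The measure of the plane, named apart so that it can carry the
    sigma-finiteness that Fubini's theorem on the square of the plane needs. *)
Definition plane_measure (R : realType) : set (plane R) -> \bar R :=
  leb2 R.

HB.instance Definition _ (R : realType) :=
  Measure.copy (plane_measure R) (leb2 R).

Lemma plane_measure_sigma_finite (R : realType) :
  sigma_finite setT (plane_measure R).
Proof.
pose I (n : nat) : set (measurableTypeR R) := `[- n%:R, n%:R]%classic.
have mI n : measurable (I n) by exact: measurable_itv.
have fI n : (lebesgue_measure (I n) < +oo)%E.
  by rewrite lebesgue_measure_itv; case: ifP => _; rewrite ?ltry// -EFinD ltry.
exists (fun n => I n `*` I n).
  apply/seteqP; split=> [[x y] _|//]; exists (Num.bound (`|x| + `|y|)) => //=.
  have xy := @archi_boundP R (`|x| + `|y|) (addr_ge0 (normr_ge0 _) (normr_ge0 _)).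
  rewrite /I /= !in_itv /= -!ler_norml; split; apply: ltW; apply: le_lt_trans xy.
    by rewrite lerDl.
  by rewrite lerDr.
move=> n; split; first exact: measurableX.
rewrite [X in (X < _)%E](_ : _ =
    lebesgue_measure (I n) * lebesgue_measure (I n))%E; last first.
  exact: (product_measure1E lebesgue_measure lebesgue_measure).
rewrite lte_mul_pinfty//.
by rewrite ge0_fin_numE.
Qed.

HB.instance Definition _ (R : realType) :=
  Measure_isSigmaFinite.Build _ _ _ (plane_measure R)
    (plane_measure_sigma_finite R).

Section PlaneFourier.
Context {R : realType}.
Implicit Types (f k phi : plane R -> R[i]) (x y xi : plane R).

Lemma plane_exchange k phi (E : plane R * plane R -> R[i]) (C : R) :
  cintegrable (leb2 R) k -> cintegrable (leb2 R) phi -> cmeasurable E ->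
  (forall z, normc (E z) <= C) ->
  cintegral (leb2 R) (fun y => phi y * cintegral (leb2 R) (fun x => k x * E (x, y))) =
  cintegral (leb2 R) (fun x => k x * cintegral (leb2 R) (fun y => phi y * E (x, y))).
Proof.
exact: (@cintegral_exchange _ _ _ _ R (plane_measure R) (plane_measure R)).
Qed.

Lemma measurable_fun_plane {d} {T : measurableType d} (u : T -> plane R) :
  measurable_fun setT (fun t => (u t).1) ->
  measurable_fun setT (fun t => (u t).2) -> measurable_fun setT u.
Proof. by move=> m1 m2; exact/measurable_fun_pairP. Qed.

Definition planewave (z : plane R * plane R) : R[i] :=
  expi (- (2 * pi * dot z.1 z.2)).

Lemma measurable_dot {d} {T : measurableType d} (u v : T -> plane R) :
  measurable_fun setT u -> measurable_fun setT v ->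
  measurable_fun setT (fun t => dot (u t) (v t)).
Proof.
move=> mu mv; apply: measurable_funD; apply: measurable_funM;
  by apply: measurableT_comp.
Qed.

Lemma cmeasurable_expi {d} {T : measurableType d} (u : T -> R) :
  measurable_fun setT u -> cmeasurable (fun t => expi (u t)).
Proof.
move=> mu; split.
  apply: (measurableT_comp (f := @cos R)) => //.
  by apply: continuous_measurable_fun; exact: continuous_cos.
apply: (measurableT_comp (f := @sin R)) => //.
by apply: continuous_measurable_fun; exact: continuous_sin.
Qed.

Lemma cmeasurable_planewave {d} {T : measurableType d} (u v : T -> plane R) :
  measurable_fun setT u -> measurable_fun setT v ->
  cmeasurable (fun t => planewave (u t, v t)).
Proof.
move=> mu mv; apply: cmeasurable_expi.
apply: measurable_funN; apply: measurable_funM => //.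
exact: measurable_dot.
Qed.

Lemma fourier2E f xi :
  fourier2 f xi = cintegral (leb2 R) (fun x => f x * planewave (x, xi)).
Proof. by []. Qed.

Lemma dotC x y : dot x y = dot y x.
Proof. by rewrite /dot mulrC [X in _ + X]mulrC. Qed.

Lemma dotDl x y xi : dot (x + y) xi = dot x xi + dot y xi.
Proof. by rewrite /dot /=; ring. Qed.

Lemma normc_planewave z : normc (planewave z) = 1.
Proof. exact: normc_expi. Qed.

Lemma planewaveC x y : planewave (x, y) = planewave (y, x).
Proof. by rewrite /planewave /= dotC. Qed.

Lemma planewaveD x y xi :
  planewave (x + y, xi) = planewave (x, xi) * planewave (y, xi).
Proof. by rewrite /planewave /= -expiD dotDl mulrDr opprD. Qed.

Lemma cintegrable_wave f (w : plane R -> R[i]) : cintegrable (leb2 R) f ->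
  cmeasurable w -> (forall x, normc (w x) = 1) ->
  cintegrable (leb2 R) (fun x => f x * w x).
Proof.
by move=> fi mw w1; apply: (cintegrable_bounded _ _ _ 1) => // x; rewrite w1.
Qed.

Lemma cmeasurable_fourier2 f : pmeasurable f -> pmeasurable (fourier2 f).
Proof.
move=> mf.
apply: (@cmeasurable_cintegral _ _ _ _ R (plane_measure R)
  (fun z : plane R * plane R => f z.1 * planewave z)).
apply: cmeasurableM; first exact: (cmeasurable_comp fst).
rewrite (_ : planewave = fun z => planewave (z.1, z.2)); last first.
  by apply/funext => -[].
exact: cmeasurable_planewave.
Qed.

Lemma fourier2_bounded f : cintegrable (leb2 R) f ->
  exists C : R, forall xi, normc (fourier2 f xi) <= C.
Proof.
move=> fi; exists (2 * \int[leb2 R]_x normc (f x)) => xi.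
apply: (le_trans (normc_cintegral_le _ _ _)).
  apply: (cintegrable_wave f (fun x => planewave (x, xi))) => // [|x].
    exact: cmeasurable_planewave.
  exact: normc_planewave.
by under eq_Rintegral do rewrite normcM normc_expi mulr1.
Qed.

(** The kernel of the transform is symmetric, so exchanging the integrals
    moves the transform from one factor to the other. *)
Lemma fourier2_multiplication f phi :
  cintegrable (leb2 R) f -> cintegrable (leb2 R) phi ->
  cintegral (leb2 R) (fun xi => phi xi * fourier2 f xi) =
  cintegral (leb2 R) (fun x => f x * fourier2 phi x).
Proof.
move=> fi pi.
transitivity (cintegral (leb2 R) (fun xi => phi xi *
    cintegral (leb2 R) (fun x => f x * planewave (x, xi)))); first by [].
etransitivity; first apply: (plane_exchange f phi planewave 1) => //.
- rewrite (_ : planewave = fun z => planewave (z.1, z.2)); last first.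
    by apply/funext => -[].
  exact: cmeasurable_planewave.
- by move=> z; rewrite normc_planewave.
- apply: eq_cintegral => x; congr (_ * _).
  by apply: eq_cintegral => y; rewrite planewaveC.
Qed.

Lemma fourier2_at0 f : fourier2 f 0 = cintegral (leb2 R) f.
Proof.
by apply: eq_cintegral => x; rewrite /dot /= !mulr0 addr0 mulr0 oppr0 expi0 mulr1.
Qed.

Definition box (M : R) : set (plane R) := [set x | `|x.1| <= M /\ `|x.2| <= M].

Definition box_supported (M : R) f : Prop :=
  {ae leb2 R, forall x, ~ box M x -> f x = 0}.

(** These are the test functions of the whole argument: pairing with one of
    them kills the Fourier transform of every function supported in the box. *)
Definition annihilator (M : R) phi : Prop :=
  cintegrable (leb2 R) phi /\ forall x, box M x -> fourier2 phi x = 0.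

Lemma boxD (M r : R) x y : box M x -> box r y -> box (M + r) (x + y).
Proof.
by move=> [x1 x2] [y1 y2]; split;
  apply: (le_trans (ler_normD _ _)); exact: lerD.
Qed.

(** In the space variable, multiplying by [fourier2 k \o L] averages translates
    by [L' y], with [y] in the support of [k]. These translations have size at
    most [r], so the box where the transform vanishes loses a margin [r]. *)
Lemma annihilator_mul (M r rho : R) phi k (L L' : plane R -> plane R) :
  cintegrable (leb2 R) k -> box_supported rho k ->
  measurable_fun setT L -> measurable_fun setT L' ->
  (forall y xi, dot y (L xi) = dot (L' y) xi) ->
  (forall y, box rho y -> box r (L' y)) ->
  annihilator (M + r) phi ->
  annihilator M (fun xi => phi xi * fourier2 k (L xi)).
Proof.
move=> ki k0 mL mL' adj bd [ip phi0].
have mF : pmeasurable (fun xi => fourier2 k (L xi)).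
  apply: (cmeasurable_comp L) => //; apply: cmeasurable_fourier2.
  exact: cintegrable_measurable ki.
have [C kC] := fourier2_bounded k ki.
split; first by apply: cintegrable_bounded => // xi; exact: kC.
move=> x Mx.
rewrite fourier2E.
(* Both characters go into one bounded kernel, so that a single exchange of
   integrals suffices. *)
pose E (z : plane R * plane R) := planewave (z.1, L z.2) * planewave (z.2, x).
have mE : cmeasurable E.
  apply: cmeasurableM; apply: cmeasurable_planewave => //.
  exact: (measurableT_comp mL).
have E1 z : normc (E z) <= 1 by rewrite normcM !normc_planewave mulr1.
transitivity (cintegral (leb2 R) (fun xi => phi xi *
    cintegral (leb2 R) (fun y => k y * E (y, xi)))).
  apply: eq_cintegral => xi; rewrite -mulrA; congr (_ * _).
  rewrite mulrC fourier2E -cintegralZl.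
    by apply: eq_cintegral => y; rewrite /E/= mulrCA [X in _ * X]mulrC.
  apply: (cintegrable_wave k (fun y => planewave (y, L xi))) => // [|y].
    exact: cmeasurable_planewave.
  exact: normc_planewave.
etransitivity; first exact: (plane_exchange k phi E 1).
have -> : (fun y => k y * cintegral (leb2 R) (fun xi => phi xi * E (y, xi)))
   = (fun y => k y * fourier2 phi (L' y + x)).
  apply/funext => y; congr (_ * _); apply: eq_cintegral => xi; congr (_ * _).
  rewrite -[RHS]/(planewave (xi, L' y + x)) [RHS]planewaveC planewaveD.
  by rewrite /E/= (planewaveC x); congr (_ * _); rewrite /planewave /= adj.
apply: cintegral_ae0.
  apply: cmeasurableM; first exact: cintegrable_measurable ki.
  apply: (cmeasurable_comp (fun y => L' y + x) (fourier2 phi)).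
    apply: measurable_fun_plane; apply: measurable_funD => //;
      exact: measurableT_comp.
  exact: cmeasurable_fourier2 (cintegrable_measurable _ _ ip).
apply: filterS k0 => y ky.
have [/bd by_|/ky ->] := pselect (box rho y); last by rewrite mul0r.
by rewrite phi0 ?mulr0// addrC; exact: boxD.
Qed.

Lemma fourier2_conj k xi : cintegrable (leb2 R) k ->
  (fourier2 k xi)^* = fourier2 (fun x => (k x)^*) (- xi).
Proof.
move=> ki; rewrite fourier2E -cintegral_conj.
  apply: eq_cintegral => x; rewrite [LHS]rmorphM; congr (_ * _).
  by rewrite [LHS]conj_expi; congr expi; rewrite /dot /=; ring.
apply: (cintegrable_wave k (fun x => planewave (x, xi))) => // [|x].
  exact: cmeasurable_planewave.
exact: normc_planewave.
Qed.

(** The squared modulus is the transform of [k] times that of its reflected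
    conjugate, hence two margins of width [r]. *)
Lemma annihilator_power (M r rho : R) phi k (L L' : plane R -> plane R) :
  cintegrable (leb2 R) k -> box_supported rho k ->
  measurable_fun setT L -> measurable_fun setT L' ->
  (forall y xi, dot y (L xi) = dot (L' y) xi) ->
  (forall y, box rho y -> box r (L' y)) ->
  annihilator (M + r + r) phi ->
  annihilator M (fun xi => phi xi * (normc (fourier2 k (L xi)) ^+ 2)%:C).
Proof.
move=> ki k0 mL mL' adj bd ap.
(* The conjugate of a transform is the transform of the conjugate at the
   opposite frequency. *)
rewrite (_ : (fun _ => _) = (fun xi => (phi xi * fourier2 k (L xi)) *
    fourier2 (fun x => (k x)^*) (- L xi))); last first.
  by apply/funext => xi; rewrite -fourier2_conj// sqr_normcE mulrA.
apply: (annihilator_mul _ r rho _ _ (fun xi => - L xi) (fun y => - L' y)).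
- exact: cintegrable_conj.
- by apply: filterS k0 => x kx /kx ->; rewrite conjc0.
- by apply: measurable_fun_plane; apply: measurable_funN;
    exact: measurableT_comp.
- by apply: measurable_fun_plane; apply: measurable_funN;
    exact: measurableT_comp.
- move=> y xi; have := adj y xi; rewrite /dot /=; lra.
- by move=> y /bd[? ?]; split; rewrite /= normrN.
- exact: annihilator_mul adj bd ap.
Qed.

(** The pairing is the Fourier transform of the product at the origin. *)
Lemma annihilator_integral (r : R) phi k :
  cintegrable (leb2 R) k -> box_supported r k -> annihilator r phi ->
  cintegral (leb2 R) (fun xi => phi xi * fourier2 k xi) = 0.
Proof.
move=> ki k0 ap; rewrite -fourier2_at0.
have [] := annihilator_mul 0 r r phi k id id ki k0 _ _ _ _ _ => //.
  by rewrite add0r.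
by move=> _; apply; rewrite /box /= normr0.
Qed.

End PlaneFourier.

(** * Affine substitution and the cosine kernel on the line *)

Section LineSubstitution.
Context {R : realType}.
Let leb := @lebesgue_measure R.

Lemma measurable_affine (a c : R) :
  measurable_fun [set: measurableTypeR R]
    ((fun x => a * x + c) : _ -> measurableTypeR R).
Proof. by apply: measurable_funD => //; apply: measurable_funM. Qed.

Lemma lebesgue_measure_affine (a c : R) (A : set (measurableTypeR R)) :
  0 < a -> measurable A ->
  pushforward leb ((fun x => a * x + c) : _ -> measurableTypeR R) A =
  (a^-1%:E * leb A)%E.
Proof.
move=> a0 mA.
have aV : 0 <= a^-1 by rewrite invr_ge0 ltW.
have [h hE] : exists h : measurableTypeR R -> measurableTypeR R,
  h = (fun x => a * x + c) by exists (fun x => a * x + c).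
have mh : measurable_fun setT h by rewrite hE; exact: measurable_affine.
rewrite -hE.
pose mu' : {measure set (measurableTypeR R) -> \bar R} :=
  mscale (NngNum (ltW a0)) (pushforward leb h).
have H : leb A = mu' mh A.
  apply: (@lebesgue_measure_unique R (mu' mh)) => //= _ [[p q]] _ <-.
  rewrite /mu' /mscale /= /pushforward.
  have -> : h @^-1` `]p, q] = `](p - c) / a, (q - c) / a]%classic.
    apply/seteqP; split => x; rewrite hE /= !in_itv/= => /andP[].
      move=> pa aq; apply/andP; split.
        by rewrite ltr_pdivrMr// ltrBlDr mulrC.
      by rewrite ler_pdivlMr// lerBrDr mulrC.
    move=> pa aq; apply/andP; split.
      by move: pa; rewrite ltr_pdivrMr// ltrBlDr mulrC.
    by move: aq; rewrite ler_pdivlMr// lerBrDr mulrC.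
  rewrite /= !lebesgue_measure_itv /= !lte_fin ltr_pM2r ?invr_gt0//.
  rewrite ltrD2r; case: ifPn => // _; last by rewrite mule0.
  by rewrite -!EFinD -EFinM -mulrBl mulrC divfK ?gt_eqF//; congr EFin; ring.
rewrite H /mu' /mscale /= muleA -EFinM mulVf ?gt_eqF// mul1e //.
Qed.

Lemma ge0_integral_affine (a c : R) (f : R -> \bar R) : 0 < a ->
  measurable_fun setT f -> (forall x, 0 <= f x)%E ->
  (\int[leb]_x f (a * x + c)%R = (a^-1)%R%:E * \int[leb]_x f x)%E.
Proof.
move=> a0 mf f0.
have aV : 0 <= a^-1 by rewrite invr_ge0 ltW.
have mh := measurable_affine a c.
pose nu : {measure set (measurableTypeR R) -> \bar R} :=
  pushforward leb ((fun x => a * x + c) : measurableTypeR R -> measurableTypeR R).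
transitivity (\int[nu mh]_x f x)%E.
  by rewrite ge0_integral_pushforward// preimage_setT.
rewrite (@eq_measure_integral _ _ _ _ (mscale (NngNum aV) leb)).
  by rewrite ge0_integral_mscale.
by move=> A mA _; exact: lebesgue_measure_affine.
Qed.

Lemma integrable_affine (a c : R) (f : R -> R) : 0 < a ->
  leb.-integrable setT (EFin \o f) ->
  leb.-integrable setT (EFin \o (fun x => f (a * x + c))).
Proof.
move=> a0 /integrableP[mf fi]; apply/integrableP; split.
  exact: (measurableT_comp mf (measurable_affine a c)).
have mf' : measurable_fun setT (fun x => `|(f x)%:E|%E).
  exact: measurableT_comp mf.
rewrite (ge0_integral_affine a c (fun x => `|(f x)%:E|%E) a0 mf')//.
by rewrite lte_mul_pinfty// ?lee_fin ?invr_ge0 ?ltW.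
Qed.

Lemma ge0_integral_opp (f : R -> \bar R) :
  measurable_fun setT f -> (forall x, 0 <= f x)%E ->
  (\int[leb]_x f (- x)%R = \int[leb]_x f x)%E.
Proof.
move=> mf f0.
have mN : measurable_fun [set: measurableTypeR R] (-%R : _ -> measurableTypeR R).
  exact: oppr_measurable.
pose nu : {measure set (measurableTypeR R) -> \bar R} :=
  pushforward leb (-%R : measurableTypeR R -> measurableTypeR R).
transitivity (\int[nu mN]_x f x)%E.
  by rewrite ge0_integral_pushforward// preimage_setT.
by apply: eq_measure_integral => A mA _; exact: lebesgue_measureN.
Qed.

Lemma Rintegral_opp (f : R -> R) : leb.-integrable setT (EFin \o f) ->
  \int[leb]_x f (- x) = \int[leb]_x f x.
Proof.
move=> fi; rewrite /Rintegral; congr fine.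
have mN : measurable_fun [set: measurableTypeR R] (-%R : _ -> measurableTypeR R).
  exact: oppr_measurable.
have mf : measurable_fun setT (EFin \o f) by exact: measurable_int fi.
pose nu : {measure set (measurableTypeR R) -> \bar R} :=
  pushforward leb (-%R : measurableTypeR R -> measurableTypeR R).
have nuE (g : R -> \bar R) : (\int[nu mN]_x g x = \int[leb]_x g x)%E.
  by apply: eq_measure_integral => A mA _; exact: lebesgue_measureN.
have fiN : leb.-integrable ((-%R : _ -> measurableTypeR R) @^-1` setT)
    ((EFin \o f) \o (-%R : _ -> measurableTypeR R)).
  rewrite preimage_setT; apply/integrableP; split.
    exact: (measurableT_comp mf mN).
  rewrite [ltLHS](ge0_integral_opp (fun x => `|(f x)%:E|%E)).
  - by case/integrableP : fi.
  - exact: measurableT_comp mf.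
  - by move=> x; exact: abse_ge0.
by rewrite -[RHS]nuE (integral_pushforward mN)// preimage_setT.
Qed.

Lemma Rintegral_odd (f : R -> R) : leb.-integrable setT (EFin \o f) ->
  (forall x, f (- x) = - f x) -> \int[leb]_x f x = 0.
Proof.
move=> fi fN; have := Rintegral_opp f fi.
under eq_Rintegral do rewrite fN -mulN1r.
by rewrite RintegralZl//; lra.
Qed.

End LineSubstitution.

Section CosineKernel.
Context {R : realType}.
Let leb := @lebesgue_measure R.

(** Source of compactly supported Fourier transforms: the integral over [x] is
    proportional to the absolute value of [b], and compactly supported piecewise
    linear functions are combinations of absolute values. *)
Definition cosine_kernel (b x : R) : R := (1 - cos (b * x)) / x ^+ 2.

Lemma abs_sin_le (x : R) : `|sin x| <= `|x|.
Proof.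
wlog x0 : x / 0 < x.
  move=> H; have [x0|x0|->] := ltgtP x 0; last by rewrite sin0.
    by rewrite -(normrN x) -(normrN (sin x)) -sinN; apply: H; rewrite oppr_gt0.
  exact: H.
have [c _] := @MVT R (@sin R) (@cos R) 0 x x0
  (fun y _ => is_derive_sin y) (continuous_subspaceT (@continuous_sin R)).
rewrite sin0 !subr0 => ->.
by rewrite normrM ler_piMl// cos_max.
Qed.

Lemma one_minus_cos_le (x : R) : 1 - cos x <= x ^+ 2 / 2.
Proof.
have -> : x = (x / 2) *+ 2 by rewrite mulr2n; lra.
set y := x / 2; rewrite cos_mulr2n cos2sin2.
have : sin y ^+ 2 <= y ^+ 2.
  by rewrite -(real_normK (num_real (sin y))) -(real_normK (num_real y))
    ler_sqr ?nnegrE// abs_sin_le.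
have -> : (y *+ 2) ^+ 2 / 2 = 2 * y ^+ 2 by rewrite mulr2n; field.
rewrite mulr2n; lra.
Qed.

Lemma cosine_kernel_ge0 b x : 0 <= cosine_kernel b x.
Proof. by rewrite divr_ge0 ?sqr_ge0// subr_ge0 cos_le1. Qed.

(** The numerator is bounded by [2] and by [(b * x) ^+ 2 / 2]; adding both
    bounds gives a majorant valid for all [x], including [0], where the quotient
    is [0] by convention. *)
Lemma cosine_kernel_le b x :
  cosine_kernel b x <= (b ^+ 2 + 2) * (1 + x ^+ 2)^-1.
Proof.
have x2 := sqr_ge0 x; have b2 := sqr_ge0 b.
have x1 : 0 < 1 + x ^+ 2 by lra.
rewrite ler_pdivlMr//.
have [->|x0] := eqVneq x 0.
  by rewrite /cosine_kernel mulr0 cos0 subrr mul0r mul0r; lra.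
have xp : 0 < x ^+ 2 by rewrite exprn_even_gt0.
rewrite mulrDr mulr1 /cosine_kernel divfK ?gt_eqF//.
have : (1 - cos (b * x)) / x ^+ 2 <= b ^+ 2.
  rewrite ler_pdivrMr// -exprMn; apply: (le_trans (one_minus_cos_le _)).
  have := sqr_ge0 (b * x); lra.
have := cos_geN1 (b * x); lra.
Qed.

Lemma cosine_kernel_le_cst b x : cosine_kernel b x <= b ^+ 2 + 2.
Proof.
apply: (le_trans (cosine_kernel_le b x)).
have b2 := sqr_ge0 b; have x2 := sqr_ge0 x.
by rewrite ler_piMr// ?invf_le1; lra.
Qed.

Lemma measurable_cosine_kernel b : measurable_fun setT (cosine_kernel b).
Proof.
apply: measurable_funM.
  apply: measurable_funB => //; apply: (measurableT_comp (f := @cos R)) => //.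
  by apply: continuous_measurable_fun; exact: continuous_cos.
rewrite (_ : (fun _ => _) = (@powR R ^~ (-1)) \o (fun x => x ^+ 2)).
  by apply: measurableT_comp; [exact: measurable_powR|exact: exprn_measurable].
by apply/funext => x /=; rewrite powR_inv1// sqr_ge0.
Qed.

Lemma integrable_oneDsqrV :
  leb.-integrable setT (EFin \o (fun x : R => (1 + x ^+ 2)^-1)).
Proof.
have m1 : measurable_fun setT (fun x : R => (1 + x ^+ 2)^-1).
  by apply: continuous_measurable_fun; exact: continuous_oneDsqrV.
apply/integrableP; split; first exact/measurable_EFinP.
have p0 (x : R) : 0 <= (1 + x ^+ 2)^-1.
  by rewrite invr_ge0 addr_ge0 ?sqr_ge0.
under eq_integral => x _ do rewrite /= ger0_norm//.
have half : (\int[leb]_(x in `[0%R, +oo[) ((1 + x ^+ 2)^-1)%:E < +oo)%E.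
  by rewrite [ltLHS]integral0y_oneDsqr ltry.
have halfN : (\int[leb]_(x in `]-oo, 0%R]) ((1 + x ^+ 2)^-1)%:E < +oo)%E.
  have := @ge0_integration_by_substitution0 R (fun x : R => ((1 + x ^+ 2)^-1)%:E)
    ((measurable_EFinP _ _).2 m1) (fun x => p0 x).
  rewrite [X in _ = X -> _](_ : _ =
    \int[leb]_(x in `]-oo, 0%R]) ((1 + x ^+ 2)^-1)%:E)%E; first by move=> <-.
  by apply: eq_integral => x _; rewrite sqrrN.
have -> : [set: R] = `]-oo, 0%R[ `|` `[0%R, +oo[.
  apply/seteqP; split=> // x _ /=; rewrite !in_itv /= andbT.
  by have [x0|x0] := ltP x 0; [left|right].
have m1E (A : set (measurableTypeR R)) :
    measurable_fun A (fun x : R => ((1 + x ^+ 2)^-1)%:E).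
  by apply/measurable_EFinP; exact: measurable_funTS.
rewrite ge0_integral_setU//=; last 2 first.
- by move=> x _; rewrite lee_fin.
- rewrite disj_set2E; apply/eqP/seteqP; split => // x /=.
  by rewrite !in_itv /= andbT => -[x0]; rewrite leNgt x0.
apply: lte_add_pinfty half.
apply: le_lt_trans halfN; apply: ge0_subset_integral => //.
- by move=> x _; rewrite lee_fin.
- by move=> x /=; rewrite !in_itv /=; exact: ltW.
Qed.

End CosineKernel.

(** * Trapezoids as Fourier transforms *)

Section TestFunctions.
Context {R : realType}.
Let leb := @lebesgue_measure R.

Lemma integrable_cosine_kernel b :
  leb.-integrable setT (EFin \o @cosine_kernel R b).
Proof.
apply: (@le_integrable _ _ _ leb _ measurableT _
  (fun x => (b ^+ 2 + 2)%:E * ((1 + x ^+ 2)^-1)%:E)%E) => //.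
- by apply/measurable_EFinP; exact: measurable_cosine_kernel.
- move=> x _ /=; rewrite lee_fin (ger0_norm (cosine_kernel_ge0 _ _)).
  exact: le_trans (cosine_kernel_le _ _) (ler_norm _).
- by apply: integrableZl => //; exact: integrable_oneDsqrV.
Qed.

(** This number is [pi]; its positivity makes the transforms of the test
    functions nonzero. *)
Definition cosine_mass : R := \int[leb]_x cosine_kernel 1 x.

Lemma cosine_mass_gt0 : 0 < cosine_mass.
Proof.
have c1 : cos (1 : R) < 1.
  have px := @pi_ge2 R.
  have i0 : (0 : R) \in `[0, pi] by rewrite in_itv /=; lra.
  have i1 : (1 : R) \in `[0, pi] by rewrite in_itv /=; lra.
  by rewrite -[ltRHS]cos0 ltr_cos// ltr01.
pose e : R := (1 - cos 1) / 4.
have e0 : 0 < e by rewrite divr_gt0// subr_gt0.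
have ke (x : R) : x \in `[1, 2] -> e <= cosine_kernel 1 x.
  rewrite in_itv /= => /andP[x1 x2]; rewrite /e /cosine_kernel mul1r.
  have px := @pi_ge2 R.
  have cx : cos x <= cos 1.
    have i1 : (1 : R) \in `[0, pi] by rewrite in_itv /=; lra.
    have ix : x \in `[0, pi] by rewrite in_itv /=; lra.
    by rewrite leNgt ltr_cos// -leNgt.
  have xx : x ^+ 2 <= 4 by rewrite expr2; nra.
  have x0 : 0 < x ^+ 2 by rewrite exprn_gt0//; lra.
  rewrite ler_pdivrMr// mulrAC ler_pdivlMr//; nra.
have : (e%:E <= (\int[leb]_x (cosine_kernel 1 x)%:E))%E.
  have -> : (e%:E = \int[leb]_(x in `[1%R, 2%R]) e%:E)%E.
    rewrite integral_cst//= lebesgue_measure_itv /= lte_fin ifT; last lra.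
    by rewrite -EFinD -EFinM; congr EFin; lra.
  have mk (A : set (measurableTypeR R)) :
      measurable_fun A (EFin \o @cosine_kernel R 1).
    by apply/measurable_EFinP; apply: measurable_funTS; exact: measurable_cosine_kernel.
  apply: (@le_trans _ _ (\int[leb]_(x in `[1%R, 2%R]) (cosine_kernel 1 x)%:E)%E).
    apply: ge0_le_integral => //.
    by move=> x _; rewrite lee_fin ltW.
  apply: ge0_subset_integral => //.
  by move=> x _; rewrite lee_fin cosine_kernel_ge0.
have fi := integrable_fin_num measurableT (integrable_cosine_kernel 1).
rewrite -(fineK fi) lee_fin => H; exact: lt_le_trans e0 H.
Qed.

(** Dilating by a positive [b] multiplies the kernel by [b ^+ 2] and the length
    by the inverse of [b]. *)
Lemma Rintegral_cosine_kernel b :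
  \int[leb]_x cosine_kernel b x = cosine_mass * `|b|.
Proof.
wlog b0 : b / 0 < b.
  move=> H; have [b0|b0|->] := ltgtP b 0.
  - rewrite -normrN -H ?oppr_gt0//; apply: eq_Rintegral => x _.
    by rewrite /cosine_kernel mulNr cosN.
  - exact: H.
  - rewrite normr0 mulr0 /Rintegral integral0_eq// => x _.
    by rewrite /cosine_kernel mul0r cos0 subrr mul0r.
have mk1 : measurable_fun setT (EFin \o @cosine_kernel R 1).
  by apply/measurable_EFinP; exact: measurable_cosine_kernel.
have H : (\int[leb]_x (cosine_kernel 1 (b * x + 0))%:E =
     b^-1%:E * \int[leb]_x (cosine_kernel 1 x)%:E)%E.
  rewrite (ge0_integral_affine b 0 (EFin \o cosine_kernel 1))//.
  by move=> x; rewrite lee_fin cosine_kernel_ge0.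
have E : (\int[leb]_x (cosine_kernel b x)%:E =
    (b ^+ 2)%:E * \int[leb]_x (cosine_kernel 1 (b * x + 0))%:E)%E.
  rewrite -ge0_integralZl//=.
  - apply: eq_integral => x _; rewrite -EFinM; congr EFin.
    rewrite /cosine_kernel addr0 mul1r.
    have [->|x0] := eqVneq x 0; first by rewrite !mulr0 cos0 subrr !mul0r mulr0.
    by field; rewrite x0 gt_eqF.
  - by apply: (measurableT_comp mk1); exact: measurable_affine.
  - by move=> x _; rewrite lee_fin cosine_kernel_ge0.
  - by rewrite lee_fin sqr_ge0.
rewrite /Rintegral E H muleA -EFinM fineM//=; last first.
  exact: integrable_fin_num (integrable_cosine_kernel 1).
rewrite -/(Rintegral _ _ _) -/cosine_mass mulrC gtr0_norm//; congr (_ * _).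
by rewrite expr2 mulfK ?gt_eqF.
Qed.

(** For [0 <= p < q]: the height [2 * (q - p)] on [-p, p], zero outside [-q, q],
    affine in between. *)
Definition trapezoid (p q x : R) : R :=
  `|q + x| + `|q - x| - `|p + x| - `|p - x|.

(** The kernels combine to [(cos (2 pi p xi) - cos (2 pi q xi)) / xi ^+ 2], and
    the character translates the transform by [a]. *)
Definition trapezoid_spectrum (p q a xi : R) : R[i] :=
  (cosine_kernel (2 * pi * q) xi - cosine_kernel (2 * pi * p) xi)%:C *
  expi (2 * pi * (a * xi)).

Lemma cmeasurable_trapezoid_spectrum p q a :
  cmeasurable (trapezoid_spectrum p q a).
Proof.
apply: cmeasurableM.
  by apply: cmeasurable_real; apply: measurable_funB;
    exact: measurable_cosine_kernel.
by apply: cmeasurable_expi; do 2 apply: measurable_funM => //.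
Qed.

Lemma cintegrable_trapezoid_spectrum p q a :
  cintegrable (leb1 R) (trapezoid_spectrum p q a).
Proof.
apply: (cintegrable_le (leb1 R) _
    (fun x => cosine_kernel (2 * pi * q) x + cosine_kernel (2 * pi * p) x)).
- exact: cmeasurable_trapezoid_spectrum.
- rewrite (_ : _ \o _ = (EFin \o cosine_kernel (2 * pi * q)) \+
    (EFin \o cosine_kernel (2 * pi * p)))%E//.
  by apply: integrableD => //; exact: integrable_cosine_kernel.
- move=> x; rewrite normcM normc_expi mulr1 normc_realC.
  apply: (le_trans (ler_normB _ _)).
  by rewrite !ger0_norm ?cosine_kernel_ge0.
Qed.

Lemma normc_trapezoid_spectrum_le p q a : exists C : R, forall x,
  normc (trapezoid_spectrum p q a x) <= C.
Proof.
exists ((2 * pi * q) ^+ 2 + 2 + ((2 * pi * p) ^+ 2 + 2)) => x.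
rewrite normcM normc_expi mulr1 normc_realC.
apply: (le_trans (ler_normB _ _)).
by rewrite !ger0_norm ?cosine_kernel_ge0// lerD// cosine_kernel_le_cst.
Qed.

Lemma cosine_kernelM (q b x : R) :
  (cosine_kernel q x) * cos (b * x) =
  2^-1 * (cosine_kernel (q + b) x + cosine_kernel (q - b) x) - cosine_kernel b x.
Proof.
rewrite /cosine_kernel; have [->|x0] := eqVneq x 0.
  by rewrite !mulr0 cos0 subrr !mul0r addr0 mulr0 subr0.
rewrite [(q + b) * x]mulrDl [(q - b) * x]mulrBl cosD cosB; field.
by [].
Qed.

(** Product-to-sum formulas turn the real part into four cosine kernels of
    frequencies [q + (x - a)], [q - (x - a)], [p + (x - a)], [p - (x - a)], whose
    integrals are absolute values; the imaginary part is odd. *)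
Lemma trapezoid_spectrum_transform p q a x :
  cintegral (leb1 R)
    (fun xi => trapezoid_spectrum p q a xi * expi (- (2 * pi * (xi * x)))) =
  (pi * cosine_mass * trapezoid p q (x - a))%:C.
Proof.
pose b := 2 * pi * (x - a).
pose k xi := cosine_kernel (2 * pi * q) xi - cosine_kernel (2 * pi * p) xi.
have E xi : trapezoid_spectrum p q a xi * expi (- (2 * pi * (xi * x))) =
    (k xi)%:C * expi (- (b * xi)).
  by rewrite /trapezoid_spectrum -mulrA -expiD; congr (_ * expi _); rewrite /b; ring.
have ik : cintegrable (leb1 R) (fun xi => (k xi)%:C * expi (- (b * xi))).
  under eq_fun do rewrite -E.
  apply: (cintegrable_bounded (leb1 R) _ _ 1).
  - exact: cintegrable_trapezoid_spectrum.
  - apply: cmeasurable_expi; apply: measurable_funN.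
    by do 2 apply: measurable_funM => //.
  - by move=> y; rewrite normc_expi.
have [rk jk] := ik.
rewrite (eq_cintegral (leb1 R) _ _ E); apply: complex_eq; rewrite /cintegral /=; last first.
  apply: Rintegral_odd jk _ => xi /=; rewrite /k /cosine_kernel !mulrN !cosN sqrrN.
  by rewrite opprK sinN !mul0r !addr0 mulrN opprK.
have H c := integrable_cosine_kernel c.
rewrite (@eq_Rintegral _ _ _ leb _ (fun xi =>
   2^-1 * ((cosine_kernel (2 * pi * q + b) xi + cosine_kernel (2 * pi * q - b) xi) -
   (cosine_kernel (2 * pi * p + b) xi + cosine_kernel (2 * pi * p - b) xi)))); last first.
  move=> xi _ /=; rewrite mul0r subr0 cosN /k mulrBl !cosine_kernelM; ring.
rewrite RintegralZl//; last first.
  rewrite (_ : _ \o _ = ((EFin \o cosine_kernel (2 * pi * q + b)) \+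
   (EFin \o cosine_kernel (2 * pi * q - b))) \-
   ((EFin \o cosine_kernel (2 * pi * p + b)) \+
   (EFin \o cosine_kernel (2 * pi * p - b))))%E//.
  by apply: integrableB => //; apply: integrableD.
have HD c d : leb.-integrable setT (EFin \o (fun y => cosine_kernel c y + cosine_kernel d y)).
  rewrite (_ : _ \o _ = (EFin \o cosine_kernel c) \+ (EFin \o cosine_kernel d))%E//.
  exact: integrableD.
rewrite RintegralB; [|by []|exact: HD|exact: HD].
rewrite !RintegralD// !Rintegral_cosine_kernel.
have N (c : R) : `|2 * pi * c| = 2 * pi * `|c|.
  by rewrite !normrM (ger0_norm (@pi_ge0 R)) ger0_norm.
rewrite /b -!mulrDr -!mulrBr !N /trapezoid.
by field.
Qed.

End TestFunctions.

(** * Functions orthogonal to products of trapezoids *)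

Section PiSystemNull.
Context {d d'} {T : measurableType d} {T' : measurableType d'} {R : realType}.
Variable mu : {measure set T -> \bar R}.

(** Dynkin induction on the sets over whose preimage the integral vanishes.
    The map [h] lets the induction run on one coordinate at a time. *)
Lemma integral_preimage_eq0 (h : T -> T') (G : set (set T')) (D : set T)
    (f : T -> \bar R) :
  measurable_fun setT h -> @measurable _ T' = <<s G >> -> setI_closed G ->
  measurable D -> mu.-integrable D f ->
  (\int[mu]_(x in D) f x = 0)%E ->
  (forall A, G A -> \int[mu]_(x in h @^-1` A `&` D) f x = 0)%E ->
  forall A, measurable A -> (\int[mu]_(x in h @^-1` A `&` D) f x = 0)%E.
Proof.
move=> mh GE GI mD fD D0 G0 A.
have mpre (B : set T') : measurable B -> measurable (h @^-1` B).
  by move=> mB; rewrite -[X in measurable X]setTI; exact: mh.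
have mI (B : set T') : measurable B -> measurable (h @^-1` B `&` D).
  by move=> mB; apply: measurableI => //; exact: mpre.
have mf := measurable_int _ fD.
rewrite GE; apply: (@dynkin_induction _ T' G
  [set A | \int[mu]_(x in h @^-1` A `&` D) f x = 0]%E) => //=.
- by rewrite preimage_setT setTI.
- move=> S mS S0.
  (* Complements: the integrals over the two pieces of [D] add up to zero. *)
  have E : D = (h @^-1` S `&` D) `|` (h @^-1` (~` S) `&` D).
    by rewrite -setIUl preimage_setC setUv setTI.
  have := D0; rewrite [in X in X -> _]E integral_setU.
  + by rewrite S0 add0e.
  + exact: mI.
  + by apply: mI; exact: measurableC.
  + by rewrite -E.
  + by rewrite disj_set2E setIACA preimage_setC setICr set0I.
- move=> F mF tF F0; rewrite preimage_bigcup setI_bigcupl integral_bigcup.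
  + by rewrite eseries0.
  + apply/trivIsetP => i j _ _ ij; rewrite setIACA setIid -preimage_setI.
    by move/trivIsetP : tF => ->//; rewrite preimage_set0 set0I.
  + by move=> k; exact: mI.
  + apply: integrableS fD => //.
      by apply: bigcupT_measurable => k; exact: mI.
    by move=> x [k _ []].
Qed.

End PiSystemNull.

Section Ramps.
Context {R : realType}.

Lemma trapezoid_out (p q x : R) : 0 <= p -> p < q -> q <= `|x| ->
  trapezoid p q x = 0.
Proof.
rewrite /trapezoid => p0 pq; case: (ger0P x) => x0 qx;
case: (ger0P (q + x)); case: (ger0P (q - x));
case: (ger0P (p + x)); case: (ger0P (p - x)); move=> *; lra.
Qed.

Lemma trapezoid_in (p q x : R) : 0 <= p -> p < q -> `|x| <= p ->
  trapezoid p q x = 2 * (q - p).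
Proof.
rewrite /trapezoid => p0 pq; case: (ger0P x) => x0 qx;
case: (ger0P (q + x)); case: (ger0P (q - x));
case: (ger0P (p + x)); case: (ger0P (p - x)); move=> *; lra.
Qed.

Lemma trapezoid_le (p q x : R) : 0 <= p -> p < q ->
  0 <= trapezoid p q x <= 2 * (q - p).
Proof.
rewrite /trapezoid => p0 pq; apply/andP; split;
case: (ger0P (q + x)); case: (ger0P (q - x));
case: (ger0P (p + x)); case: (ger0P (p - x)); move=> *; lra.
Qed.

(** A trapezoid of height [1] whose sides steepen with [n], so that it tends to
    the indicator of an open interval. *)
Definition ramp (q : R) (n : nat) (x : R) : R :=
  trapezoid (q - q / n.+1%:R) q x / (2 * (q / n.+1%:R)).

Let ramp_param (q : R) n : 0 < q ->
  [/\ 0 <= q - q / n.+1%:R, q - q / n.+1%:R < q & 0 < q / n.+1%:R].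
Proof.
move=> q0; have e0 : 0 < q / n.+1%:R by rewrite divr_gt0.
split=> //; last by rewrite ltrBlDr ltrDl.
by rewrite subr_ge0 ler_pdivrMr// ler_pMr// ler1n.
Qed.

Lemma ramp_out q n x : 0 < q -> q <= `|x| -> ramp q n x = 0.
Proof.
by move=> /(ramp_param _ n)[? ? ?] qx; rewrite /ramp trapezoid_out// mul0r.
Qed.

Lemma ramp_le q n x : 0 < q -> 0 <= ramp q n x <= 1.
Proof.
move=> /(ramp_param _ n)[p0 pq e0].
have /andP[t0 t1] := trapezoid_le _ _ x p0 pq.
have e2 : 0 < 2 * (q / n.+1%:R) by rewrite mulr_gt0.
apply/andP; split; first exact: divr_ge0 t0 (ltW e2).
rewrite ler_pdivrMr// mul1r (le_trans t1)//.
by rewrite opprB addrC subrK.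
Qed.

(** Inside the interval the sequence is eventually constant, outside it is
    zero. *)
Lemma ramp_cvg q x : 0 < q ->
  ramp q n x @[n --> \oo] --> (\1_`]- q, q[%classic x : R).
Proof.
move=> q0; have [qx|xq] := leP q `|x|.
  rewrite indicE memNset.
    by under eq_fun do rewrite ramp_out//; exact: cvg_cst.
  by rewrite /= in_itv /= -ltr_norml; apply/negP; rewrite -leNgt.
rewrite indicE mem_set; last by rewrite /= in_itv /= -ltr_norml.
apply: cvg_near_cst; near=> n.
have [p0 pq e0] := ramp_param _ n q0.
rewrite /ramp trapezoid_in//.
  by rewrite opprB addrC subrK divff// mulf_neq0 ?gt_eqF.
have : q / (q - `|x|) <= n.+1%:R.
  apply: (@le_trans _ _ n%:R); last by rewrite ler_nat.
  by near: n; exact: nbhs_infty_ger.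
have qx : 0 < q - `|x| by rewrite subr_gt0.
rewrite ler_pdivrMr// mulrC => H.
have : q / n.+1%:R <= q - `|x| by rewrite ler_pdivrMr.
by rewrite lerBrDr addrC -lerBrDr.
Unshelve. all: by end_near. Qed.

Lemma measurable_trapezoid p q : measurable_fun setT (@trapezoid R p q).
Proof.
rewrite /trapezoid.
have m (c : R) (s : R) : measurable_fun setT (fun x : R => `|c + s * x|).
  apply: measurableT_comp => //; by apply: measurable_funD => //; apply: measurable_funM.
apply: measurable_funB; first apply: measurable_funB; first apply: measurable_funD.
- by have := m q 1; under eq_fun do rewrite mul1r.
- by have := m q (-1); under eq_fun do rewrite mulN1r.
- by have := m p 1; under eq_fun do rewrite mul1r.
- by have := m p (-1); under eq_fun do rewrite mulN1r.
Qed.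

End Ramps.

Section OrthogonalToRamps.
Context {R : realType}.

Definition rect (u v u' v' : R) : set (plane R) :=
  (`]u, v[%classic : set R) `*` (`]u', v'[%classic : set R).

Lemma measurable_rect u v u' v' : measurable (rect u v u' v').
Proof. by apply: measurableX; exact: measurable_itv. Qed.

Lemma rect_rayl u v u' v' t :
  fst @^-1` `]-oo, t[%classic `&` rect u v u' v' = rect u (Num.min t v) u' v'.
Proof.
apply/seteqP; split => -[x y] ; rewrite /rect /= !in_itv /= lt_min.
  by move=> [-> [/andP[-> ->] ->]].
by move=> [/andP[-> /andP[-> ->]] ->].
Qed.

Lemma rect_rayr u v u' v' t :
  snd @^-1` `]-oo, t[%classic `&` rect u v u' v' = rect u v u' (Num.min t v').
Proof.
apply/seteqP; split => -[x y] ; rewrite /rect /= !in_itv /= lt_min.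
  by move=> [-> [-> /andP[-> ->]]].
by move=> [-> /andP[-> /andP[-> ->]]].
Qed.

Lemma rays_setI_closed : setI_closed (@RGenInftyO.G R).
Proof.
move=> _ _ [x ->] [y ->]; exists (Num.min x y); apply/seteqP.
by split => z /=; rewrite !in_itv /= lt_min => /andP.
Qed.

Variables (f : plane R -> R) (M : R).
Hypothesis mf : measurable_fun setT f.
Hypothesis M0 : 0 <= M.
Hypothesis floc : forall u v u' v',
  (leb2 R).-integrable (rect u v u' v') (EFin \o f).
Hypothesis fortho : forall q q' n a a', 0 < q -> 0 < q' ->
  M + q <= `|a| \/ M + q' <= `|a'| ->
  \int[leb2 R]_x (f x * (ramp q n (x.1 - a) * ramp q' n (x.2 - a'))) = 0.

Definition off (u v : R) := M <= u \/ v <= - M.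

Lemma off_center u v : u < v -> off u v -> M + (v - u) / 2 <= `|(u + v) / 2|.
Proof.
have M0' := M0; move=> uv [Mu|vM].
  by rewrite ger0_norm; lra.
by rewrite ler0_norm; lra.
Qed.

Lemma centered u v (x : R) :
  (\1_`]- ((v - u) / 2), (v - u) / 2[%classic (x - (u + v) / 2) : R) =
  \1_`]u, v[%classic x.
Proof.
rewrite !indicE; congr (_%:R); congr nat_of_bool.
apply/idP/idP; rewrite !inE /= !in_itv /= => /andP[? ?]; apply/andP; split; lra.
Qed.

(** Dominated convergence: the products of ramps tend to the indicator of the
    rectangle and vanish outside of it. *)
Lemma integral_rect u v u' v' : off u v \/ off u' v' ->
  (\int[leb2 R]_(x in rect u v u' v') (f x)%:E = 0)%E.
Proof.
have [vu _|uv] := leP v u.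
  rewrite (_ : rect _ _ _ _ = set0) ?integral_set0//.
  apply/seteqP; split => // -[x y] [] /=; rewrite in_itv /= => /andP[ux xv].
  by have := lt_trans ux xv; rewrite ltNge vu.
have [vu _|uv'] := leP v' u'.
  rewrite (_ : rect _ _ _ _ = set0) ?integral_set0//.
  apply/seteqP; split => // -[x y] [_] /=; rewrite in_itv /= => /andP[ux xv].
  by have := lt_trans ux xv; rewrite ltNge vu.
move=> offs.
pose q := (v - u) / 2; pose a := (u + v) / 2.
pose q' := (v' - u') / 2; pose a' := (u' + v') / 2.
have q0 : 0 < q by rewrite divr_gt0// subr_gt0.
have q0' : 0 < q' by rewrite divr_gt0// subr_gt0.
(* In the coordinate where the interval avoids [-M, M], its centre is at
   distance at least [M] plus half its length from the origin. *)
have aq : M + q <= `|a| \/ M + q' <= `|a'|.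
  by case: offs => ?; [left|right]; exact: off_center.
pose D := rect u v u' v'.
have mD : measurable D by exact: measurable_rect.
have DE (x : plane R) : \1_D x = \1_`]-q, q[%classic (x.1 - a) *
    \1_`]-q', q'[%classic (x.2 - a') :> R.
  by rewrite !centered /D /rect !indicE in_setX -natrM mulnb.
pose h n (x : plane R) : \bar R :=
  (f x * (ramp q n (x.1 - a) * ramp q' n (x.2 - a')))%:E.
have mr (c b : R) n (pr : plane R -> measurableTypeR R) : measurable_fun setT pr ->
    measurable_fun setT (fun x => ramp c n (pr x - b)).
  move=> mpr; apply: measurable_funM => //.
  apply: measurableT_comp; first exact: measurable_trapezoid.
  exact: measurable_funB.
have mh n : measurable_fun setT (h n).
  by apply/measurable_EFinP; do 2 apply: measurable_funM => //; apply: mr.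
have cvh : {ae leb2 R, forall x, setT x ->
    h n x @[n --> \oo] --> (f x * \1_D x)%:E}.
  apply: aeW => x _; apply: cvg_EFin; first exact: nearW.
  apply: cvgMr; rewrite DE; apply: cvgM; exact: ramp_cvg.
have iD : (leb2 R).-integrable setT (fun x => (`|f x * \1_D x|)%:E).
  have := floc u v u' v'; rewrite -/D integrable_mkcond//.
  move=> /integrable_abse; apply: eq_integrable => // x _ /=.
  by rewrite patchE indicE; case: ifP => _; rewrite ?mulr1 ?mulr0 ?normr0 ?abse0.
have hle x n : (`|h n x| <= (`|f x * \1_D x|)%:E)%E.
  rewrite /h abse_EFin lee_fin.
  rewrite normrM (normrM (f x)) ler_wpM2l//.
  have /andP[r0 r1] := ramp_le q n (x.1 - a) q0.
  have /andP[s0 s1] := ramp_le q' n (x.2 - a') q0'.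
  rewrite (ger0_norm (mulr_ge0 r0 s0)) indicE; case: (boolP (x \in D)) => xD.
    by rewrite normr1; exact: mulr_ile1.
  have := DE x; rewrite indicE (negbTE xD) => /esym/eqP; rewrite mulf_eq0 => xE.
  have out (c b : R) : 0 < c -> \1_`]-c, c[%classic b == 0 :> R -> ramp c n b = 0.
    move=> c0 /eqP b0; apply: ramp_out => //; rewrite leNgt; apply/negP => bc.
    move/eqP: b0; rewrite indicE mem_set ?oner_eq0//.
    by rewrite /= in_itv /= -ltr_norml.
  by case/orP : xE => /out ->//; rewrite ?(normr0, mul0r, mulr0).
have mfD : measurable_fun setT (fun x => (f x * \1_D x)%:E).
  by apply/measurable_EFinP; apply: measurable_funM => //; exact: measurable_indic.
have [_ _] := dominated_convergence measurableT mh mfD cvh iD (aeW _ (fun x n _ => hle x n)).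
have h0 n : (\int[leb2 R]_x h n x = 0)%E.
  have := fortho q q' n a a' q0 q0' aq; rewrite /Rintegral => /eqP.
  rewrite fine_eq0 => [/eqP //|].
  apply: integrable_fin_num => //.
  apply: (@le_integrable _ _ _ (leb2 R) _ measurableT _
    (fun x => (`|f x * \1_D x|)%:E)) => //.
  - exact: mh.
  - by move=> x _; rewrite [leRHS]abse_EFin normr_id; exact: hle.
move=> cvI; have cv0 : (\int[leb2 R]_x h n x)%E @[n --> \oo] --> 0%E.
  by under eq_fun do rewrite h0; exact: cvg_cst.
rewrite integral_mkcond -[RHS](cvg_unique (@ereal_hausdorff R) cvI cv0).
apply: eq_integral => x _.
by rewrite patchE indicE; case: ifP => _; rewrite ?mulr1 ?mulr0.
Qed.



Lemma off_min u v t : off u v -> off u (Num.min t v).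
Proof.
by move=> [|vM]; [left|right]; rewrite // (le_trans _ vM)// ge_min lexx orbT.
Qed.

Let raysE : @measurable _ (measurableTypeR R) = <<s @RGenInftyO.G R >>.
Proof. exact: RGenInftyO.measurableE. Qed.

(** A ray cuts a rectangle that avoids the box into another such rectangle, and
    rays generate the Borel sets. *)
Lemma integral_strip u v u' v' (A : set (measurableTypeR R)) :
  off u v \/ off u' v' -> measurable A ->
  (\int[leb2 R]_(x in fst @^-1` A `&` rect u v u' v') (f x)%:E = 0)%E.
Proof.
move=> offs; apply: (@integral_preimage_eq0 _ _ (plane R) (measurableTypeR R) R
  (leb2 R) fst (@RGenInftyO.G R)) => //.
- exact: rays_setI_closed.
- exact: measurable_rect.
- exact: integral_rect.
- move=> _ [t ->]; rewrite rect_rayl; apply: integral_rect.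
  by case: offs => offs; [left; exact: off_min|right].
Qed.

Lemma integral_box u v u' v' (A B : set (measurableTypeR R)) :
  off u v \/ off u' v' -> measurable A -> measurable B ->
  (\int[leb2 R]_(x in (A `*` B) `&` rect u v u' v') (f x)%:E = 0)%E.
Proof.
move=> offs mA mB.
have mfst : measurable (fst @^-1` A : set (plane R)).
  by rewrite -[X in measurable X]setTI; exact: (@measurable_fst _ _ _ _ measurableT).
rewrite (_ : A `*` B = snd @^-1` B `&` fst @^-1` A); last first.
  by apply/seteqP; split => x [].
rewrite -setIA; move: B mB.
apply: (@integral_preimage_eq0 _ _ (plane R) (measurableTypeR R) R
  (leb2 R) snd (@RGenInftyO.G R)) => //.
- exact: rays_setI_closed.
- by apply: measurableI => //; exact: measurable_rect.
- apply: integrableS (floc u v u' v') => //; first exact: measurable_rect.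
  by apply: measurableI => //; exact: measurable_rect.
- exact: integral_strip.
- move=> _ [t ->]; rewrite setICA rect_rayr; apply: integral_strip => //.
  by case: offs => offs; [left|right; exact: off_min].
Qed.

Lemma integral_off u v u' v' (E : set (plane R)) :
  off u v \/ off u' v' -> measurable E ->
  (\int[leb2 R]_(x in E `&` rect u v u' v') (f x)%:E = 0)%E.
Proof.
move=> offs; apply: (@integral_preimage_eq0 _ _ (plane R) (plane R) R
  (leb2 R) id [set A `*` B | A in measurable & B in measurable]) => //.
- exact: measurable_prod_measurableType.
- move=> _ _ [A mA [B mB <-]] [C mC [D mD <-]].
  exists (A `&` C); first exact: measurableI.
  by exists (B `&` D); [exact: measurableI|rewrite setXI].
- exact: measurable_rect.
- exact: integral_rect.
- by move=> _ [A mA [B mB <-]]; exact: integral_box.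
Qed.

Lemma ae_rect u v u' v' : off u v \/ off u' v' ->
  {ae leb2 R, forall x, rect u v u' v' x -> f x = 0}.
Proof.
move=> offs.
have := @integral_ae_eq _ _ _ (leb2 R) (rect u v u' v') (measurable_rect _ _ _ _)
  (cst 0%E) (EFin \o f) (floc u v u' v') (measurable_cst _).
have H E : E `<=` rect u v u' v' -> measurable E ->
    (\int[leb2 R]_(x in E) (EFin \o f) x = \int[leb2 R]_(x in E) cst 0%E x)%E.
  move=> ED mE; rewrite integral0 -(integral_off u v u' v' E)//.
  by rewrite (setIidl ED).
by move=> /(_ H); apply: filterS => x /[apply] -[].
Qed.

(** The complement of the box is a countable union of rectangles that avoid
    it. *)
Lemma ae_off_box : {ae leb2 R, forall x, ~ box M x -> f x = 0}.
Proof.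
have H n : {ae leb2 R, forall x,
    [/\ rect M n%:R (- n%:R) n%:R x -> f x = 0,
        rect (- n%:R) (- M) (- n%:R) n%:R x -> f x = 0,
        rect (- n%:R) n%:R M n%:R x -> f x = 0 &
        rect (- n%:R) n%:R (- n%:R) (- M) x -> f x = 0]}.
  have offr (w : R) : off M w by left.
  have offl (w : R) : off w (- M) by right.
  have h1 := ae_rect M n%:R (- n%:R) n%:R (or_introl (offr _)).
  have h2 := ae_rect (- n%:R) (- M) (- n%:R) n%:R (or_introl (offl _)).
  have h3 := ae_rect (- n%:R) n%:R M n%:R (or_intror (offr _)).
  have h4 := ae_rect (- n%:R) n%:R (- n%:R) (- M) (or_intror (offl _)).
  by apply: filterS2 (filterI h1 h2) (filterI h3 h4) => x [? ?] [? ?]; split.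
have := ae_foralln H; apply: filterS => -[x y] Hxy nbox.
pose n := Num.bound (`|x| + `|y|).
have xyn : `|x| + `|y| < n%:R.
  exact: archi_boundP (addr_ge0 (normr_ge0 _) (normr_ge0 _)).
have : `|x| < n%:R by apply: le_lt_trans xyn; rewrite lerDl.
have : `|y| < n%:R by apply: le_lt_trans xyn; rewrite lerDr.
rewrite !ltr_norml => /andP[ny yn] /andP[nx xn].
have [h1 h2 h3 h4] := Hxy n.
have [xM|Mx] := leP `|x| M; last first.
  move: Mx; rewrite lter_normr => /orP[Mx|Mx].
    by apply: h1; rewrite /rect /= !in_itv /= Mx xn ny yn.
  by apply: h2; rewrite /rect /= !in_itv /= ltrNr Mx nx ny yn.
have [yM|My] := leP `|y| M; first by exfalso; apply: nbox.
move: My; rewrite lter_normr => /orP[My|My].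
  by apply: h3; rewrite /rect /= !in_itv /= My yn nx xn.
by apply: h4; rewrite /rect /= !in_itv /= ltrNr My ny nx xn.
Qed.

End OrthogonalToRamps.

(** * Test functions on the plane *)

Section PlaneTests.
Context {R : realType}.

Definition ramp_spectrum (q a q' a' : R) (n : nat) (xi : plane R) : R[i] :=
  trapezoid_spectrum (q - q / n.+1%:R) q a xi.1 *
  trapezoid_spectrum (q' - q' / n.+1%:R) q' a' xi.2.

Lemma cintegrable_ramp_spectrum q a q' a' n :
  cintegrable (leb2 R) (ramp_spectrum q a q' a' n).
Proof.
exact: (cintegrable_tensor (@lebesgue_measure R) (@lebesgue_measure R) _ _
  (cintegrable_trapezoid_spectrum _ _ _) (cintegrable_trapezoid_spectrum _ _ _)).
Qed.

Lemma ramp_spectrum_bounded q a q' a' n : exists C : R, forall xi,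
  normc (ramp_spectrum q a q' a' n xi) <= C.
Proof.
have [C hC] := @normc_trapezoid_spectrum_le R (q - q / n.+1%:R) q a.
have [C' hC'] := @normc_trapezoid_spectrum_le R (q' - q' / n.+1%:R) q' a'.
exists (C * C') => xi; rewrite normcM.
by apply: ler_pM => //; exact: normc_ge0.
Qed.

Lemma cintegrable_leb1_expi (u : measurableTypeR R -> R[i]) (x : R) :
  cintegrable (leb1 R) u ->
  cintegrable (leb1 R) (fun t => u t * expi (- (2 * pi * (t * x)))).
Proof.
move=> iu; apply: (cintegrable_bounded (leb1 R) _ _ 1) => //.
  apply: cmeasurable_expi; apply: measurable_funN.
  by do 2 apply: measurable_funM => //.
by move=> t; rewrite normc_expi.
Qed.

Lemma fourier2_tensor (u v : measurableTypeR R -> R[i]) (x : plane R) :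
  cintegrable (leb1 R) u -> cintegrable (leb1 R) v ->
  fourier2 (fun z => u z.1 * v z.2) x = fourier1 u x.1 * fourier1 v x.2.
Proof.
move=> iu iv.
have := cintegral_tensor (@lebesgue_measure R) (@lebesgue_measure R) _ _
  (cintegrable_leb1_expi u x.1 iu) (cintegrable_leb1_expi v x.2 iv).
move=> <-; apply: eq_cintegral => z.
rewrite mulrACA -expiD; congr (_ * expi _).
by rewrite /dot; ring.
Qed.

Lemma fourier2_ramp_spectrum q a q' a' n : 0 < q -> 0 < q' ->
  exists2 c : R, 0 < c & forall x,
  fourier2 (ramp_spectrum q a q' a' n) x =
  (c * (ramp q n (x.1 - a) * ramp q' n (x.2 - a')))%:C.
Proof.
move=> q0 q0'.
have e0 : 0 < 2 * (q / n.+1%:R) by rewrite mulr_gt0// divr_gt0.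
have e0' : 0 < 2 * (q' / n.+1%:R) by rewrite mulr_gt0// divr_gt0.
pose k : R := pi * cosine_mass.
have k0 : 0 < k by rewrite mulr_gt0 ?pi_gt0 ?cosine_mass_gt0.
exists ((k * (2 * (q / n.+1%:R))) * (k * (2 * (q' / n.+1%:R)))).
  by apply: mulr_gt0; apply: mulr_gt0.
move=> x; rewrite fourier2_tensor.
- rewrite /fourier1 !trapezoid_spectrum_transform -rmorphM; congr (_ %:C).
  rewrite /ramp -/k; field.
  by rewrite nat1r pnatr_eq0 /= !gt_eqF.
- exact: cintegrable_trapezoid_spectrum.
- exact: cintegrable_trapezoid_spectrum.
Qed.

(** The transform vanishes outside the open rectangle of centre [(a, a')] and
    half-widths [q] and [q'], which one of the two distance conditions keeps
    away from the box. *)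
Lemma annihilator_ramp_spectrum M q a q' a' n : 0 < q -> 0 < q' ->
  M + q <= `|a| \/ M + q' <= `|a'| ->
  annihilator M (ramp_spectrum q a q' a' n).
Proof.
move=> q0 q0' off; split; first exact: cintegrable_ramp_spectrum.
move=> x [x1 x2]; have [c _ ->] := fourier2_ramp_spectrum q a q' a' n q0 q0'.
have H (w b t : R) : `|t| <= M -> M + w <= `|b| -> w <= `|t - b|.
  by move=> tM wb; have := lerB_dist b t; rewrite distrC; lra.
case: off => H1.
  by rewrite (ramp_out q)//; [rewrite mul0r mulr0|exact: H].
by rewrite (ramp_out q')//; [rewrite !mulr0|exact: H].
Qed.

End PlaneTests.

(** * Square-integrable functions of compact support *)

Section SquareIntegrable.
Context {d} {T : measurableType d} {R : realType}.
Variable mu : {measure set T -> \bar R}.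

Lemma Lfun2_bounded (u : T -> R) (C : R) : mu.-integrable setT (EFin \o u) ->
  (forall x, `|u x| <= C) -> u \in Lfun mu 2%:E.
Proof.
move=> iu uC; have mu_ := measurable_int _ iu.
have mu' : measurable_fun setT u by exact/measurable_EFinP.
rewrite inE /=; apply/andP; split; first by rewrite inE.
rewrite inE /finite_norm unlock /Lnorm; apply: poweR_lty.
have : mu.-integrable setT (EFin \o (fun x => u x * u x)).
  apply: (@le_integrable _ _ _ mu _ measurableT _ (fun x => C%:E * (EFin \o u) x)%E) => //.
  - by apply/measurable_EFinP; exact: measurable_funM.
  - move=> x _ /=; rewrite lee_fin !normrM ler_wpM2r//.
    exact: le_trans (uC x) (ler_norm _).
  - exact: integrableZl.
move=> /integrableP[_]; apply: le_lt_trans.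
rewrite le_eqVlt; apply/orP; left; apply/eqP/eq_integral => x _.
by rewrite /= (powR_mulrn 2)// expr2 -normrM.
Qed.

Lemma Lfun2_indic (D : set T) : measurable D -> (mu D < +oo)%E ->
  (\1_D : T -> R) \in Lfun mu 2%:E.
Proof.
move=> mD fD; apply: (Lfun2_bounded _ 1).
  apply/integrableP; split.
    by apply/measurable_EFinP; exact: measurable_indic.
  rewrite (eq_integral (fun x => (\1_D x)%:E)); first by rewrite integral_indic// setIT.
  by move=> t _; rewrite /= ger0_norm.
by move=> x; rewrite indicE ger0_norm// lern1 leq_b1.
Qed.

Lemma Lfun2_integrable_supp (u : T -> R) (D : set T) : u \in Lfun mu 2%:E ->
  measurable D -> (mu D < +oo)%E -> {ae mu, forall x, ~ D x -> u x = 0} ->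
  mu.-integrable setT (EFin \o u).
Proof.
move=> u2 mD fD u0.
have mu' : measurable_fun setT u.
  by have := sub_Lfun_mfun u2; rewrite inE.
have /Lfun1_integrable /integrableP[_ iD] := Lfun2_mul_Lfun1 u2 (Lfun2_indic D mD fD).
apply/integrableP; split; first exact/measurable_EFinP.
apply: le_lt_trans iD; rewrite le_eqVlt; apply/orP; left.
apply/eqP/ge0_ae_eq_integral => //.
- by apply: measurableT_comp => //; exact/measurable_EFinP.
- apply: measurableT_comp => //; apply/measurable_EFinP.
  by apply: measurable_funM => //; exact: measurable_indic.
- apply: filterS u0 => x ux _ /=; rewrite indicE.
  by case: (boolP (x \in D)) => [_|/negP]; rewrite ?mulr1// inE => /ux ->; rewrite mul0r.
Qed.

Lemma cLp2_integrable_supp (f : T -> R[i]) (D : set T) : cLp mu 2%:E f ->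
  measurable D -> (mu D < +oo)%E -> {ae mu, forall x, ~ D x -> f x = 0} ->
  cintegrable mu f.
Proof.
move=> [rf jf] mD fD f0; split; apply: (Lfun2_integrable_supp _ D) => //;
  by apply: filterS f0 => x fx /fx /= ->.
Qed.

End SquareIntegrable.

Section CompactSupport.
Context {R : realType}.

Lemma measurable_box (M : R) : measurable (box M : set (plane R)).
Proof.
rewrite (_ : box M = (`[- M, M]%classic : set R) `*` (`[- M, M]%classic : set R)).
  by apply: measurableX; exact: measurable_itv.
by apply/seteqP; split => -[x y] /=; rewrite /box /= !in_itv /= -!ler_norml.
Qed.

Lemma lebesgue_measure_itv_lty (u v : R) :
  (lebesgue_measure (`[u, v]%classic : set R) < +oo)%E.
Proof. by rewrite lebesgue_measure_itv; case: ifP => _; rewrite ?ltry// -EFinD ltry. Qed.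

Lemma leb2_box_lty (M : R) : (leb2 R (box M) < +oo)%E.
Proof.
rewrite (_ : box M = (`[- M, M]%classic : set R) `*` (`[- M, M]%classic : set R)).
  rewrite [X in (X < _)%E](product_measure1E lebesgue_measure lebesgue_measure)//.
  by rewrite lte_mul_pinfty// ?ge0_fin_numE// lebesgue_measure_itv_lty.
by apply/seteqP; split => -[x y] /=; rewrite /box /= !in_itv /= -!ler_norml.
Qed.

Lemma compact_sub_box (K : set (R * R)) : compact K -> exists M : R, K `<=` box M.
Proof.
move=> cK.
have bd (pr : R * R -> R) : continuous pr -> exists M : R, forall x, K x -> `|pr x| <= M.
  move=> cpr; have : compact (pr @` K).
    by apply: continuous_compact => //; exact: continuous_subspaceT.
  move=> /compact_bounded[M [_ HM]]; exists (M + 1) => x Kx.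
  by apply: HM; [rewrite ltrDl|exists x].
have [M1 H1] := bd fst (fun x => @cvg_fst _ _ _ _ _).
have [M2 H2] := bd snd (fun x => @cvg_snd _ _ _ _ _).
exists (Num.max M1 M2) => x Kx; split; rewrite le_max ?H1//.
by rewrite H2 ?orbT.
Qed.

Lemma compactly_supported2_box (f : plane R -> R[i]) :
  compactly_supported2 f -> exists M, box_supported M f.
Proof.
move=> [K [/compact_sub_box[M KM] f0]]; exists M.
have FF := ae_filter_ringOfSetsType (leb2 R).
by move: f0; apply: (@filterS _ _ FF) => x fx nb; apply: fx => /KM/nb.
Qed.

Lemma box_compactly_supported2 (M : R) (f : plane R -> R[i]) :
  box_supported M f -> compactly_supported2 f.
Proof.
move=> f0; exists (`[- M, M] `*` `[- M, M])%classic; split.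
  by apply: compact_setX; exact: segment_compact.
apply: filterS f0 => x fx nb; apply: fx => -[x1 x2]; apply: nb.
by split; rewrite /= in_itv /= -ler_norml.
Qed.

Lemma cLp2_box_integrable (M : R) (f : plane R -> R[i]) :
  cLp (leb2 R) 2%:E f -> box_supported M f -> cintegrable (leb2 R) f.
Proof.
move=> f2 f0; apply: (cLp2_integrable_supp (leb2 R) f (box M)) => //.
  exact: measurable_box.
exact: leb2_box_lty.
Qed.

Lemma compactly_supported1_itv (f : R -> R[i]) :
  compactly_supported1 f ->
  exists M, {ae leb1 R, forall x, ~ `[- M, M]%classic x -> f x = 0}.
Proof.
move=> [K [/compact_bounded[M [_ HM]] f0]]; exists (M + 1).
have FF := ae_filter_ringOfSetsType (leb1 R).
move: f0; apply: (@filterS _ _ FF) => x fx nb; apply: fx => Kx; apply: nb.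
by rewrite /= in_itv /= -ler_norml; apply: HM => //; rewrite ltrDl.
Qed.

Lemma cLp2_itv_integrable (M : R) (f : measurableTypeR R -> R[i]) :
  cLp (leb1 R) 2%:E f -> {ae leb1 R, forall x, ~ `[- M, M]%classic x -> f x = 0} ->
  cintegrable (leb1 R) f.
Proof.
move=> f2 f0; apply: (cLp2_integrable_supp (leb1 R) f `[- M, M]%classic) => //.
exact: lebesgue_measure_itv_lty.
Qed.

End CompactSupport.

(** * Tensor products along two affine forms *)

Section ShearedTensor.
Context {R : realType}.
Let leb := @lebesgue_measure R.

Variables (al be ga de ep : R).
Hypotheses (al0 : 0 < al) (de0 : 0 < de).

Definition line1 (z : plane R) : measurableTypeR R := al * z.1 + be * z.2 + ga.
Definition line2 (z : plane R) : measurableTypeR R := de * z.2 + ep.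

Lemma measurable_line1 : measurable_fun setT line1.
Proof.
apply: measurable_funD => //; apply: measurable_funD => //;
  by apply: measurable_funM.
Qed.

Lemma measurable_line2 : measurable_fun setT line2.
Proof. by apply: measurable_funD => //; apply: measurable_funM. Qed.

Lemma integrable_line_tensor (A B : R -> R) :
  leb.-integrable setT (EFin \o A) -> leb.-integrable setT (EFin \o B) ->
  (leb2 R).-integrable setT (EFin \o (fun z => A (line1 z) * B (line2 z))).
Proof.
move=> iA iB.
have mA : measurable_fun setT A by apply/measurable_EFinP; exact: measurable_int iA.
have mB : measurable_fun setT B by apply/measurable_EFinP; exact: measurable_int iB.
have iB' := integrable_affine de ep B de0 iB.
apply/(@integrable21ltyP _ _ _ _ _ leb leb).
  apply/measurable_EFinP; apply: measurable_funM.
    exact: (measurableT_comp mA measurable_line1).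
  exact: (measurableT_comp mB measurable_line2).
have mAe : measurable_fun setT (fun x => `|(A x)%:E|%E).
  by apply: measurableT_comp => //; exact/measurable_EFinP.
pose c := (\int[leb]_x `|(A x)%:E|)%E.
rewrite (_ : (\int[leb]_y _)%E =
  (\int[leb]_y (`|(B (de * y + ep)%R)%:E| * ((al^-1)%R%:E * c)))%E); last first.
  apply: eq_integral => y _.
  rewrite -(ge0_integral_affine al (be * y + ga) _ al0 mAe)//.
  rewrite -ge0_integralZl//=.
  - apply: eq_integral => x _.
    by rewrite /line1 /line2 /= -EFinM normrM mulrC addrA.
  - exact: (measurableT_comp mAe (measurable_affine al _)).
case/integrableP : iA => mA' iA; case/integrableP : iB' => mB' iB'.
rewrite ge0_integralZr//; last 2 first.
- exact: (measurableT_comp (@abse_measurable _ _) mB').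
- by apply: mule_ge0; [rewrite lee_fin invr_ge0 ltW|exact: integral_ge0].
apply: lte_mul_pinfty => //; first exact: integral_ge0.
  by rewrite ge0_fin_numE//; exact: integral_ge0.
by rewrite lte_mul_pinfty// lee_fin invr_ge0 ltW.
Qed.

(** Integrating first in the variable with the nonzero coefficient [al] reduces
    the claim to a scaling of the line. *)
Lemma negligible_line1 (N : set (measurableTypeR R)) : measurable N ->
  leb N = 0%E -> leb2 R (line1 @^-1` N) = 0%E.
Proof.
move=> mN N0.
have mP : measurable (line1 @^-1` N).
  by rewrite -[X in measurable X]setTI; exact: measurable_line1.
have mI : measurable_fun [set: measurableTypeR R] (EFin \o (\1_N : _ -> R)).
  by apply/measurable_EFinP; exact: measurable_indic.
transitivity (\int[leb2 R]_z ((EFin \o (\1_N : _ -> R)) (line1 z)))%E.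
  by rewrite -[X in leb2 R X]setIT -(integral_indic (leb2 R) measurableT).
rewrite [LHS](@fubini_tonelli2 _ _ _ _ _ leb leb)//; last 2 first.
- exact: (measurableT_comp mI measurable_line1).
- by move=> z; rewrite lee_fin.
rewrite integral0_eq// => y _.
transitivity (\int[leb]_x (EFin \o (\1_N : R -> R)) (al * x + (be * y + ga))%R)%E.
  by apply: eq_integral => x _; rewrite /line1 /= addrA.
rewrite (ge0_integral_affine al (be * y + ga) (EFin \o (\1_N : R -> R)) al0 mI).
  rewrite [X in (_ * X)%E](_ : _ = 0%E) ?mule0//.
  by rewrite [LHS]integral_indic// setIT; exact: N0.
by move=> x; rewrite lee_fin.
Qed.

Lemma negligible_line2 (N : set (measurableTypeR R)) : measurable N ->
  leb N = 0%E -> leb2 R (line2 @^-1` N) = 0%E.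
Proof.
move=> mN N0.
have mP : measurable (line2 @^-1` N).
  by rewrite -[X in measurable X]setTI; exact: measurable_line2.
have mI : measurable_fun [set: measurableTypeR R] (EFin \o (\1_N : _ -> R)).
  by apply/measurable_EFinP; exact: measurable_indic.
transitivity (\int[leb2 R]_z ((EFin \o (\1_N : _ -> R)) (line2 z)))%E.
  by rewrite -[X in leb2 R X]setIT -(integral_indic (leb2 R) measurableT).
rewrite [LHS](@fubini_tonelli1 _ _ _ _ _ leb leb)//; last 2 first.
- exact: (measurableT_comp mI measurable_line2).
- by move=> z; rewrite lee_fin.
rewrite integral0_eq// => x _.
transitivity (\int[leb]_y (EFin \o (\1_N : R -> R)) (de * y + ep)%R)%E => //.
rewrite (ge0_integral_affine de ep (EFin \o (\1_N : R -> R)) de0 mI).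
  rewrite [X in (_ * X)%E](_ : _ = 0%E) ?mule0//.
  by rewrite [LHS]integral_indic// setIT; exact: N0.
by move=> y; rewrite lee_fin.
Qed.

Lemma cintegrable_line_tensor (a b : measurableTypeR R -> R[i]) :
  cintegrable (leb1 R) a -> cintegrable (leb1 R) b ->
  cintegrable (leb2 R) (fun z => a (line1 z) * b (line2 z)).
Proof.
move=> ia ib.
apply: (cintegrable_le (leb2 R) _
  (fun z => normc (a (line1 z)) * normc (b (line2 z)))).
- apply: cmeasurableM.
    apply: (cmeasurable_comp line1 a measurable_line1).
    exact: cintegrable_measurable ia.
  apply: (cmeasurable_comp line2 b measurable_line2).
  exact: cintegrable_measurable ib.
- apply: (integrable_line_tensor (fun x => normc (a x)) (fun x => normc (b x))).
    exact: cintegrable_norm ia.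
  exact: cintegrable_norm ib.
- by move=> z; rewrite normcM.
Qed.

Lemma box_supported_line_tensor (a b : measurableTypeR R -> R[i]) (K K' : R) :
  {ae leb1 R, forall x, ~ `[- K, K]%classic x -> a x = 0} ->
  {ae leb1 R, forall x, ~ `[- K', K']%classic x -> b x = 0} ->
  exists M, box_supported M (fun z => a (line1 z) * b (line2 z)).
Proof.
move=> [N [mN N0 aN]] [N' [mN' N0' bN]].
pose M2 := (K' + `|ep|) / de; pose M1 := (K + `|be| * M2 + `|ga|) / al.
exists (Num.max M1 M2).
exists (line1 @^-1` N `|` line2 @^-1` N'); split.
- apply: measurableU.
    by rewrite -[X in measurable X]setTI; exact: measurable_line1.
  by rewrite -[X in measurable X]setTI; exact: measurable_line2.
- apply/eqP; rewrite -measure_le0 -[leRHS]adde0.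
  rewrite -{1}(negligible_line1 N mN N0) -(negligible_line2 N' mN' N0').
  apply: measureU2.
    by rewrite -[X in measurable X]setTI; exact: measurable_line1.
  by rewrite -[X in measurable X]setTI; exact: measurable_line2.
- move=> z /=; rewrite not_implyE => -[zbox ab0].
  apply: contrapT => /not_orP[n1 n2]; apply: zbox.
  have z1 : `|line1 z| <= K.
    apply: contrapT => H; apply: n1; apply: aN => /= H1; apply: ab0.
    by rewrite H1 ?mul0r// in_itv /= -ler_norml.
  have z2 : `|line2 z| <= K'.
    apply: contrapT => H; apply: n2; apply: bN => /= H1; apply: ab0.
    by rewrite H1 ?mulr0// in_itv /= -ler_norml.
  have h2 : `|z.2| <= M2.
    rewrite /M2 ler_pdivlMr// -(gtr0_norm de0) -normrM.
    have -> : z.2 * de = line2 z - ep by rewrite /line2; ring.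
    by apply: (le_trans (ler_normB _ _)); rewrite lerD2r.
  have h1 : `|z.1| <= M1.
    rewrite /M1 ler_pdivlMr// -(gtr0_norm al0) -normrM.
    have -> : z.1 * al = line1 z - be * z.2 - ga by rewrite /line1; ring.
    apply: (le_trans (ler_normB _ _)); rewrite lerD2r.
    apply: (le_trans (ler_normB _ _)); apply: lerD => //.
    by rewrite normrM ler_wpM2l.
  by split; rewrite le_max ?h1 ?h2 ?orbT.
Qed.

End ShearedTensor.

(** * Pairings and limits *)

Section CauchySchwarz.
Context {d} {T : measurableType d} {R : realType}.
Variable mu : {measure set T -> \bar R}.

(** Hoelder's inequality for the exponents [2] and [2]; the factor [2] comes from
    bounding the real and imaginary parts of the integral separately. *)
Lemma L2dist_pairing (u v w : T -> R[i]) :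
  cmeasurable u -> cmeasurable v -> cmeasurable w ->
  (fun x => normc (w x)) \in Lfun mu 2%:E -> (L2dist mu u v < +oo)%E ->
  cintegrable mu (fun x => (u x - v x) * w x) /\
  ((normc (cintegral mu (fun x => (u x - v x) * w x)))%:E <=
   2%:E * (L2dist mu u v * Lnorm mu 2%:E (EFin \o (fun x => normc (w x)))))%E.
Proof.
move=> mu_ mv mw w2 duv.
have muv := cmeasurableB _ _ mu_ mv.
have mn := measurable_normc _ muv.
have mnw := measurable_normc _ mw.
have uv2 : (fun x => normc (u x - v x)) \in Lfun mu 2%:E.
  by rewrite inE /=; apply/andP; split; rewrite inE.
have i1 := Lfun2_mul_Lfun1 uv2 w2.
have /Lfun1_integrable ip := i1.
have ci : cintegrable mu (fun x => (u x - v x) * w x).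
  apply: (cintegrable_le mu _ (fun x => normc (u x - v x) * normc (w x))) => //.
    exact: cmeasurableM.
  by move=> x; rewrite normcM.
split=> //.
have := normc_cintegral_le mu _ ci; rewrite -lee_fin => /le_trans; apply.
rewrite EFinM; apply: lee_wpmul2l; first by rewrite lee_fin.
have half : (2^-1 + 2^-1 = 1 :> R) by lra.
have := @hoelder _ T R mu _ _ 2 2 mn mnw (ltr0Sn _ _) (ltr0Sn _ _) half.
rewrite Lnorm1; apply: le_trans.
rewrite fineK; last first.
  by apply: integrable_fin_num => //; exact: cintegrable_norm.
rewrite le_eqVlt; apply/orP; left; apply/eqP/eq_integral => x _.
by rewrite /= normcM ger0_norm// mulr_ge0 ?normc_ge0.
Qed.

End CauchySchwarz.

Section DominatedZero.
Context {d} {T : measurableType d} {R : realType}.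
Variable mu : {measure set T -> \bar R}.

(** Dominated convergence, with the modulus of [u * H] as the dominating
    function, since the multipliers lie between [0] and [H]. *)
Lemma cintegral_multiplier_lim (u : T -> R[i]) (G : nat -> T -> R) (H : T -> R) :
  cmeasurable u -> (forall n, measurable_fun setT (G n)) ->
  (forall n x, 0 <= G n x <= H x) ->
  (forall x, G n x @[n --> \oo] --> H x) ->
  cintegrable mu (fun x => u x * (H x)%:C) ->
  (forall n, cintegral mu (fun x => u x * (G n x)%:C) = 0) ->
  cintegral mu (fun x => u x * (H x)%:C) = 0.
Proof.
move=> mu_ mG GH cG iH G0.
have [ru ju] := mu_.
have H0 x : 0 <= H x by have /andP[a b] := GH 0%N x; exact: le_trans a b.
have key (v : T -> R) (pr : R[i] -> R) : measurable_fun setT v ->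
    (forall x (r : R), pr (u x * r%:C) = v x * r) ->
    mu.-integrable setT (EFin \o (fun x => pr (u x * (H x)%:C))) ->
    (forall n, \int[mu]_x pr (u x * (G n x)%:C) = 0) ->
    \int[mu]_x pr (u x * (H x)%:C) = 0.
  move=> mv prE ipH prG.
  have mh n : measurable_fun setT (fun x => (v x * G n x)%:E).
    by apply/measurable_EFinP; exact: measurable_funM.
  have mH : measurable_fun setT (fun x => (v x * H x)%:E).
    move: (measurable_int _ ipH); congr measurable_fun.
    by apply/funext => x /=; rewrite prE.
  have cvh : {ae mu, forall x, setT x ->
      (v x * G n x)%:E @[n --> \oo] --> (v x * H x)%:E}.
    apply: aeW => x _; apply: cvg_EFin; first exact: nearW.
    by apply: cvgMr; exact: cG.
  have iD : mu.-integrable setT (fun x => `|(v x * H x)%:E|%E).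
    move/integrable_abse: ipH; congr (_.-integrable _ _).
    by apply/funext => x /=; rewrite prE.
  have hle : {ae mu, forall x n, setT x -> (`|(v x * G n x)%:E| <= `|(v x * H x)%:E|)%E}.
    apply: aeW => x n _; have /andP[a b] := GH n x.
    by rewrite !abse_EFin lee_fin !normrM ler_wpM2l// !ger0_norm.
  have [_ _] := dominated_convergence measurableT mh mH cvh iD hle.
  have h0 n : (\int[mu]_x (v x * G n x)%:E = 0)%E.
    have := prG n; under eq_Rintegral do rewrite prE.
    move=> /eqP; rewrite fine_eq0 => [/eqP //|].
    apply: integrable_fin_num => //.
    apply: (@le_integrable _ _ _ mu _ measurableT _ (fun x => `|(v x * H x)%:E|%E)) => //.
    move=> x _; have /andP[a b] := GH n x.
    by rewrite abse_id !abse_EFin lee_fin !normrM ler_wpM2l// !ger0_norm.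
  move=> cvI.
  have cv0 : (\int[mu]_x (v x * G n x)%:E)%E @[n --> \oo] --> 0%E.
    by under eq_fun do rewrite h0; exact: cvg_cst.
  under eq_Rintegral do rewrite prE.
  by rewrite /Rintegral (cvg_unique (@ereal_hausdorff R) cvI cv0).
have [rH jH] := iH.
apply: complex_eq; rewrite /cintegral /=.
  apply: (key (fun x => complex.Re (u x))) => // [x r|n].
    by rewrite ReM /= mulr0 subr0.
  by have := G0 n => -[].
apply: (key (fun x => complex.Im (u x))) => // [x r|n].
  by rewrite ImM /= mulr0 add0r.
by have := G0 n => -[].
Qed.

End DominatedZero.

Section AnnihilatorSum.
Context {R : realType}.

Lemma annihilatorD (M : R) phi psi : annihilator M phi -> annihilator M psi ->
  annihilator M (fun xi => phi xi + psi xi).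
Proof.
move=> [ip p0] [iq q0]; split; first exact: cintegrableD.
move=> x Mx; rewrite fourier2E.
under eq_cintegral do rewrite mulrDl.
have w (f : plane R -> R[i]) : cintegrable (leb2 R) f ->
    cintegrable (leb2 R) (fun y => f y * planewave (y, x)).
  move=> fi; apply: (cintegrable_wave f (fun y => planewave (y, x))) => // [|y].
    exact: cmeasurable_planewave.
  exact: normc_planewave.
rewrite cintegralD; [|exact: w|exact: w].
by rewrite -!fourier2E p0// q0// addr0.
Qed.

Lemma box_mono (M N : R) : M <= N -> box M `<=` box N.
Proof. by move=> MN x [h1 h2]; split; [exact: le_trans h1 MN|exact: le_trans h2 MN]. Qed.

End AnnihilatorSum.

Section FilterAnnihilation.
Context {R : realType}.
Variables (k g : plane R -> R[i]) (L L' : nat -> plane R -> plane R).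
Variables (rho r : R) (n0 : nat).
Hypotheses (ik : cintegrable (leb2 R) k) (ig : cintegrable (leb2 R) g).
Hypotheses (sk : box_supported r k) (sg : box_supported rho g).
Hypotheses (mL : forall j, measurable_fun setT (L j))
  (mL' : forall j, measurable_fun setT (L' j)).
Hypothesis adj : forall j y xi, dot y (L j xi) = dot (L' j y) xi.
Hypothesis bd : forall j y, box rho y -> box r (L' j y).

Definition filter_term (xi : plane R) (j : nat) : R :=
  normc (fourier2 g (L j xi)) ^+ 2.

Definition partial_filter (J : nat) (xi : plane R) : R :=
  normc (fourier2 k xi) ^+ 2 + \sum_(n0 <= j < J) filter_term xi j.

Definition full_filter (xi : plane R) : R :=
  normc (fourier2 k xi) ^+ 2 +
  fine (\sum_(n0 <= j <oo) (filter_term xi j)%:E)%E.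

Hypothesis gsum : forall xi, (\sum_(n0 <= j <oo) (filter_term xi j)%:E < +oo)%E.

Lemma annihilator_partial_filter M J phi : annihilator (M + r + r) phi ->
  annihilator M (fun xi => phi xi * (partial_filter J xi)%:C).
Proof.
move=> ap; rewrite /partial_filter.
have base : annihilator M (fun xi => phi xi * (normc (fourier2 k xi) ^+ 2)%:C).
  exact: (annihilator_power M r r phi k id id).
have [Jn|nJ] := leqP J n0.
  rewrite (_ : (fun _ => _) = (fun xi => phi xi * (normc (fourier2 k xi) ^+ 2)%:C))//.
  by apply/funext => xi; rewrite big_geq// addr0.
rewrite -(subnK (ltnW nJ)); elim: (J - n0)%N => [|i IH].
  rewrite (_ : (fun _ => _) = (fun xi => phi xi * (normc (fourier2 k xi) ^+ 2)%:C))//.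
  by apply/funext => xi; rewrite big_geq// addr0.
rewrite (_ : (fun _ => _) = (fun xi =>
    phi xi * (normc (fourier2 k xi) ^+ 2 +
       \sum_(n0 <= j < i + n0) filter_term xi j)%:C +
    phi xi * (filter_term xi (i + n0))%:C)); last first.
  by apply/funext => xi; rewrite addSn big_nat_recr ?leq_addl//= addrA rmorphD mulrDr.
apply: annihilatorD; first exact: IH.
exact: annihilator_power ig sg (mL _) (mL' _) (adj _) (bd _) ap.
Qed.

Lemma filter_term_ge0 xi j : 0 <= filter_term xi j.
Proof. exact: sqr_ge0. Qed.

Let sum_fin xi : (\sum_(n0 <= j <oo) (filter_term xi j)%:E)%E \is a fin_num.
Proof.
rewrite ge0_fin_numE; first exact: gsum.
by apply: nneseries_ge0 => j _ _; rewrite lee_fin filter_term_ge0.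
Qed.

Lemma partial_filter_le J xi : 0 <= partial_filter J xi <= full_filter xi.
Proof.
apply/andP; split.
  by rewrite addr_ge0 ?sqr_ge0// sumr_ge0// => j _; exact: filter_term_ge0.
rewrite lerD2l -lee_fin fineK// -sumEFin.
by apply: nneseries_lim_ge => j _ _; rewrite lee_fin filter_term_ge0.
Qed.

Lemma partial_filter_cvg xi : partial_filter J xi @[J --> \oo] --> full_filter xi.
Proof.
apply: cvgD; first exact: cvg_cst.
have : (\sum_(n0 <= j < J) (filter_term xi j)%:E)%E @[J --> \oo] -->
    (fine (\sum_(n0 <= j <oo) (filter_term xi j)%:E)%E)%:E.
  rewrite fineK//.
  by apply: is_cvg_nneseries => j _ _; rewrite lee_fin filter_term_ge0.
under eq_fun do rewrite sumEFin.
by move/fine_cvg.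
Qed.

Lemma measurable_partial_filter J : measurable_fun setT (partial_filter J).
Proof.
have mk := cmeasurable_fourier2 k (cintegrable_measurable _ _ ik).
have mg := cmeasurable_fourier2 g (cintegrable_measurable _ _ ig).
apply: measurable_funD.
  by apply: measurable_funX; exact: measurable_normc.
apply: measurable_sum => j; apply: measurable_funX.
by apply: (measurable_normc (fun xi => fourier2 g (L j xi)));
  exact: (cmeasurable_comp (L j)).
Qed.

Lemma measurable_full_filter : measurable_fun setT full_filter.
Proof.
apply: (@measurable_fun_cvg _ (plane R) R setT partial_filter full_filter).
  exact: measurable_partial_filter.
by move=> xi _; exact: partial_filter_cvg.
Qed.

Lemma cmeasurable_filtered (h : plane R -> R[i]) : cintegrable (leb2 R) h ->
  pmeasurable (fun xi => (full_filter xi)%:C * fourier2 h xi).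
Proof.
move=> ih; apply: cmeasurableM.
  by apply: cmeasurable_real; exact: measurable_full_filter.
exact: cmeasurable_fourier2 (cintegrable_measurable _ _ ih).
Qed.

(** Multiplied by a partial filter, the test function still annihilates the box
    that supports [h]; the partial filters increase to the full one. *)
Lemma filter_pairing_eq0 (K : R) (h phi : plane R -> R[i]) :
  cintegrable (leb2 R) h -> box_supported K h ->
  annihilator (K + r + r) phi ->
  cintegrable (leb2 R) (fun xi => phi xi * ((full_filter xi)%:C * fourier2 h xi)) ->
  cintegral (leb2 R) (fun xi => phi xi * ((full_filter xi)%:C * fourier2 h xi)) = 0.
Proof.
move=> ih sh ap.
have E : (fun xi => phi xi * ((full_filter xi)%:C * fourier2 h xi)) =
    (fun xi => (phi xi * fourier2 h xi) * (full_filter xi)%:C).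
  by apply/funext => xi; rewrite -mulrA [X in _ * X]mulrC.
rewrite E => iH.
apply: (cintegral_multiplier_lim (leb2 R) _ partial_filter full_filter) => //.
- apply: cmeasurableM; first exact: cintegrable_measurable ap.1.
  exact: cmeasurable_fourier2 (cintegrable_measurable _ _ ih).
- exact: measurable_partial_filter.
- exact: partial_filter_le.
- exact: partial_filter_cvg.
- move=> J.
  have := annihilator_integral K _ h ih sh (annihilator_partial_filter K J phi ap).
  by move=> <-; apply: eq_cintegral => xi; rewrite -!mulrA [fourier2 h xi * _]mulrC.
Qed.

End FilterAnnihilation.

Section Orthogonality.
Context {R : realType}.
Let mu := leb2 R.

Lemma bounded_Lfun2 (w : plane R -> R[i]) (C : R) : cintegrable mu w ->
  (forall x, normc (w x) <= C) -> (fun x => normc (w x)) \in Lfun mu 2%:E.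
Proof.
move=> iw wC; apply: (Lfun2_bounded mu _ C); first exact: cintegrable_norm.
by move=> x; rewrite ger0_norm ?normc_ge0.
Qed.

Lemma cLp1_cintegrable (f : plane R -> R[i]) : cLp mu 1%:E f -> cintegrable mu f.
Proof. by move=> [rf jf]; split; exact/Lfun1_integrable. Qed.

Lemma cLp_cmeasurable (p : \bar R) (f : plane R -> R[i]) : cLp mu p f -> cmeasurable f.
Proof.
by move=> [rf jf]; split; [have := sub_Lfun_mfun rf|have := sub_Lfun_mfun jf];
  rewrite inE.
Qed.

(** Along the sequence [fn] that defines the Plancherel transform, the
    multiplication formula moves the transform onto [phi]. Cauchy-Schwarz
    controls the two errors, of [fn] against [f] and of its transform against
    [F]. *)
Lemma fourier_L2_orthogonal (f F phi : plane R -> R[i]) (C C' : R) :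
  is_fourier_L2 f F -> cmeasurable F ->
  cintegrable mu phi -> (forall xi, normc (phi xi) <= C) ->
  cintegrable mu (fourier2 phi) -> (forall x, normc (fourier2 phi x) <= C') ->
  (cintegrable mu (fun xi => phi xi * F xi) ->
   cintegral mu (fun xi => phi xi * F xi) = 0) ->
  cintegral mu (fun x => f x * fourier2 phi x) = 0.
Proof.
move=> [f2 [fn [fnL cvf cvF]]] mF ip pC iP PC H0.
have p2 := bounded_Lfun2 phi C ip pC.
have P2 := bounded_Lfun2 (fourier2 phi) C' iP PC.
have mf := cLp_cmeasurable _ _ f2.
have mfn n : cmeasurable (fn n) by exact: (cLp_cmeasurable _ _ (fnL n).1).
have ifn n := cLp1_cintegrable _ (fnL n).1.
have mhfn n := cmeasurable_fourier2 _ (mfn n).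
have mp := cintegrable_measurable _ _ ip.
have mP := cintegrable_measurable _ _ iP.
have finite_near (u : nat -> \bar R) : u n @[n --> \oo] --> 0%E ->
    \forall n \near \oo, (u n < +oo)%E.
  move=> /fine_cvgP[fu _]; apply: filterS fu => n un.
  by rewrite ltey_eq un.
have nf := finite_near _ cvf; have nF := finite_near _ cvF.
have ihp n : cintegrable mu (fun xi => fourier2 (fn n) xi * phi xi).
  have [D hD] := fourier2_bounded _ (ifn n).
  rewrite (_ : (fun _ => _) = (fun xi => phi xi * fourier2 (fn n) xi)).
    exact: (cintegrable_bounded mu _ _ D).
  by apply/funext => xi; rewrite mulrC.
have ifP n : cintegrable mu (fun x => fn n x * fourier2 phi x).
  exact: (cintegrable_bounded mu _ _ C').
pose NP := Lnorm mu 2%:E (EFin \o (fun x => normc (phi x))).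
pose NQ := Lnorm mu 2%:E (EFin \o (fun x => normc (fourier2 phi x))).
have bound : \forall n \near \oo,
   ((normc (cintegral mu (fun x => f x * fourier2 phi x)))%:E <=
   2%:E * (L2dist mu (fn n) f * NQ) + 2%:E * (L2dist mu (fourier2 (fn n)) F * NP))%E.
  near=> n.
  have fin1 : (L2dist mu (fn n) f < +oo)%E by near: n.
  have fin2 : (L2dist mu (fourier2 (fn n)) F < +oo)%E by near: n.
  have [i1 b1] := L2dist_pairing mu (fn n) f (fourier2 phi) (mfn n) mf mP P2 fin1.
  have [i2 b2] := L2dist_pairing mu (fourier2 (fn n)) F phi (mhfn n) mF mp p2 fin2.
  have Fp : (fun xi => phi xi * F xi) = (fun xi =>
      fourier2 (fn n) xi * phi xi - (fourier2 (fn n) xi - F xi) * phi xi).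
    by apply/funext => xi; ring.
  have iFp : cintegrable mu (fun xi => phi xi * F xi).
    rewrite Fp; exact: cintegrableB.
  (* As [F] pairs to zero with [phi], the pairing of the transform of [fn n]
     equals that of its difference with [F]. *)
  have e2 : cintegral mu (fun xi => (fourier2 (fn n) xi - F xi) * phi xi) =
      cintegral mu (fun x => fn n x * fourier2 phi x).
    have := H0 iFp; rewrite {1}Fp cintegralB// => /eqP; rewrite subr_eq0 => /eqP <-.
    rewrite -fourier2_multiplication//.
    by apply: eq_cintegral => xi; rewrite mulrC.
  have e1 : cintegral mu (fun x => f x * fourier2 phi x) =
      cintegral mu (fun x => fn n x * fourier2 phi x) -
      cintegral mu (fun x => (fn n x - f x) * fourier2 phi x).
    rewrite -cintegralB//; apply: eq_cintegral => x; ring.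
  rewrite e1 -e2; apply: le_trans (leeD b1 b2); rewrite -EFinD lee_fin addrC.
  by apply: le_trans (le_normcD _ _) _; rewrite normcN.
apply: eq0_normc; apply/eqP; rewrite eq_le normc_ge0 andbT -lee_fin.
have fNP : NP \is a fin_num.
  rewrite ge0_fin_numE ?Lnorm_ge0//.
  by have := sub_Lfun_finLfun p2; rewrite inE.
have fNQ : NQ \is a fin_num.
  rewrite ge0_fin_numE ?Lnorm_ge0//.
  by have := sub_Lfun_finLfun P2; rewrite inE.
have lim0 (u : nat -> \bar R) (N : \bar R) : N \is a fin_num ->
    u n @[n --> \oo] --> 0%E -> (2%:E * (u n * N))%E @[n --> \oo] --> 0%E.
  move=> fN cu; rewrite -(mule0 2%:E) -(mul0e N).
  by apply: cvgeZl => //; apply: cvgeZr.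
have cvS : (2%:E * (L2dist mu (fn n) f * NQ) +
   2%:E * (L2dist mu (fourier2 (fn n)) F * NP))%E @[n --> \oo] --> 0%E.
  by rewrite -[X in _ --> X]adde0; apply: cvgeD => //; exact: lim0.
by have := cvge_ge bound cvS; apply.
Unshelve. all: by end_near. Qed.

End Orthogonality.

(** * Dilations, shears and the decay of the filter *)

Section ShearletGeometry.
Context {R : realType}.

Lemma mx22M (a b c d a' b' c' d' : R) :
  mx22 a b c d *m mx22 a' b' c' d' =
  mx22 (a * a' + b * c') (a * b' + b * d') (c * a' + d * c') (c * b' + d * d').
Proof.
apply/matrixP => i j; rewrite !mxE !big_ord_recl big_ord0 !mxE addr0 /=.
by case: i => -[|[|]]//= ?; case: j => -[|[|]].
Qed.

Lemma mx22_tr (a b c d : R) : (mx22 a b c d)^T = mx22 a c b d.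
Proof.
by apply/matrixP => i j; rewrite !mxE; case: i => -[|[|]]//= ?; case: j => -[|[|]].
Qed.

Lemma mx22_1 : mx22 1 0 0 1 = 1%:M :> 'M[R]_2.
Proof.
by apply/matrixP => i j; rewrite !mxE; case: i => -[|[|]]//= ?; case: j => -[|[|]].
Qed.

Lemma mxact22 (a b c d : R) (x : R * R) :
  mxact (mx22 a b c d) x = (a * x.1 + b * x.2, c * x.1 + d * x.2).
Proof. by rewrite /mxact !mxE. Qed.

Lemma invmx_unique n (A B : 'M[R]_n) : A *m B = 1%:M -> invmx A = B.
Proof.
by move=> AB; have [uA _] := mulmx1_unit AB; rewrite -[RHS](mulKmx uA) AB mulmx1.
Qed.

Lemma invmx_scaling j :
  invmx (scaling j) = mx22 (2 ^- j) 0 0 (2 ^- j./2) :> 'M[R]_2.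
Proof.
apply: invmx_unique; rewrite /scaling mx22M !(mulr0, mul0r, addr0, add0r).
by rewrite !mulfV ?expf_neq0// mx22_1.
Qed.

Lemma invmx_shearing (s : R) : invmx (shearing s) = mx22 1 (- s) 0 1.
Proof.
apply: invmx_unique; rewrite /shearing mx22M.
by rewrite !(mulr0, mul0r, addr0, add0r, mulr1, mul1r) addNr mx22_1.
Qed.

(** The matrix [A_j^-1 S_s^-T] at which the filter evaluates the transform of
    the generator, and below its transpose. *)
Definition freq_map (s : R) (j : nat) (xi : plane R) : plane R :=
  (2 ^- j * xi.1, 2 ^- j./2 * (xi.2 - s * xi.1)).

Definition freq_adj (s : R) (j : nat) (y : plane R) : plane R :=
  (2 ^- j * y.1 - s * (2 ^- j./2 * y.2), 2 ^- j./2 * y.2).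

Lemma freq_map0E j (xi : R * R) : mxact (invmx (scaling j)) xi = freq_map 0 j xi.
Proof.
by rewrite invmx_scaling mxact22 /freq_map !mul0r addr0 add0r subr0.
Qed.

Lemma freq_mapE s j (xi : R * R) :
  mxact (invmx (scaling j) *m (invmx (shearing s))^T) xi = freq_map s j xi.
Proof.
rewrite invmx_scaling invmx_shearing mx22_tr mx22M mxact22 /freq_map.
by congr pair; ring.
Qed.

Lemma freq_adjP s j (y xi : plane R) :
  dot y (freq_map s j xi) = dot (freq_adj s j y) xi.
Proof. by rewrite /dot /freq_map /freq_adj /=; ring. Qed.

Lemma measurable_freq_map s j : measurable_fun setT (freq_map s j).
Proof.
apply: measurable_fun_plane => /=; first by apply: measurable_funM.
apply: measurable_funM => //; apply: measurable_funB => //.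
by apply: measurable_funM.
Qed.

Lemma measurable_freq_adj s j : measurable_fun setT (freq_adj s j).
Proof.
apply: measurable_fun_plane => /=; last by apply: measurable_funM.
apply: measurable_funB; first by apply: measurable_funM.
by do 2 apply: measurable_funM => //.
Qed.

(** Negative powers of [2] contract, so one box serves all scales. *)
Lemma freq_adj_box s (rho : R) j (y : plane R) : box rho y ->
  box ((1 + `|s|) * rho) (freq_adj s j y).
Proof.
move=> [y1 y2].
have c0 k : 0 <= 2 ^- k :> R by rewrite invr_ge0 exprn_ge0.
have c1 k : 2 ^- k <= 1 :> R by rewrite invf_le1 ?exprn_gt0// exprn_ege1// ler1n.
have h k (t : R) : `|t| <= rho -> `|2 ^- k * t| <= rho.
  move=> tr; rewrite normrM (ger0_norm (c0 k)); apply: le_trans tr.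
  by rewrite ler_piMl.
split; rewrite /=; last first.
  apply: (le_trans (h _ _ y2)); rewrite ler_peMl ?lerDl//.
  exact: le_trans (normr_ge0 _) y2.
apply: (le_trans (ler_normB _ _)); rewrite mulrDl mul1r.
by apply: lerD; [exact: h|rewrite normrM ler_wpM2l// h].
Qed.

Lemma geometric_half_le (m J : nat) : \sum_(m <= j < J) (2 ^- j : R) <= 2.
Proof.
(* The stronger bound makes the induction on [J] go through; it also covers
   the empty sum. *)
suff : \sum_(m <= j < J) (2 ^- j : R) <= 2 - 2 * 2 ^- J.
  by move=> /le_trans; apply; rewrite gerBl mulr_ge0// invr_ge0 exprn_ge0.
elim: J => [|J IH]; first by rewrite big_geq// expr0 invr1 mulr1 subrr.
have p0 : 0 < 2 ^- J :> R by rewrite invr_gt0 exprn_gt0.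
have E : 2 * 2 ^- J.+1 = 2 ^- J :> R by rewrite exprS invfM mulrA mulfV ?mul1r.
rewrite E; have [mJ|Jm] := leqP m J.
  by rewrite big_nat_recr//=; lra.
rewrite big_geq//; rewrite subr_ge0.
by rewrite (@le_trans _ _ 1) ?ler1n// invf_le1 ?exprn_gt0// exprn_ege1// ler1n.
Qed.

(** As [1 <= alpha], the transform of [g] vanishes at least linearly in its
    first variable, and the first coordinate of [freq_map s j xi] is
    [2 ^- j * xi.1]: the series is dominated by a geometric one. *)
Lemma filter_sum_lty (alpha beta : R) (g : plane R -> R[i]) s n0 xi :
  1 <= alpha -> 0 <= beta ->
  bounded_upto_const (cpartial2 0 (fourier2 g))
    (fun xi => Num.min 1 (`|xi.1| `^ alpha) /
               ((1 + `|xi.1|) `^ beta * (1 + `|xi.2|) `^ beta)) ->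
  (\sum_(n0 <= j <oo) (filter_term g (freq_map s) xi j)%:E < +oo)%E.
Proof.
move=> a1 b0 [C [C0 HC]].
have G (z : plane R) : normc (fourier2 g z) <= C * Num.min 1 `|z.1|.
  have -> : fourier2 g z = cpartial2 0 (fourier2 g) z.
    by apply: complex_eq; case: z.
  apply: (le_trans (HC z)); rewrite ler_pM2l//.
  have p1 (t : R) : 1 <= (1 + `|t|) `^ beta.
    have e1 : 1 = 1 `^ beta :> R by rewrite powR1.
    rewrite [leLHS]e1; apply: ge0_ler_powR => //; rewrite ?nnegrE//.
    by rewrite lerDl.
  have m0 : 0 <= Num.min 1 (`|z.1| `^ alpha) by rewrite le_min ler01 powR_ge0.
  apply: (@le_trans _ _ (Num.min 1 (`|z.1| `^ alpha))).
    rewrite ler_piMr// invf_le1; last first.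
      by rewrite mulr_gt0// (lt_le_trans ltr01).
    by rewrite -[leLHS]mulr1 ler_pM.
  rewrite le_min ge_min lexx /=.
  have [t1|t1] := leP 1 `|z.1|; first by rewrite ge_min t1.
  rewrite ge_min; apply/orP; right.
  have [->|z0] := eqVneq `|z.1| 0; first by rewrite powR0// gt_eqF// (lt_le_trans ltr01).
  apply: ge1r_powR => //.
  by rewrite lt_neqAle eq_sym z0 normr_ge0 ltW.
have T j : filter_term g (freq_map s) xi j <= (C ^+ 2 * `|xi.1|) * 2 ^- j.
  rewrite /filter_term expr2.
  have g1 : normc (fourier2 g (freq_map s j xi)) <= C.
    by apply: (le_trans (G _)); apply: ler_piMr; [exact: ltW|rewrite ge_min lexx].
  have g2 : normc (fourier2 g (freq_map s j xi)) <= C * (2 ^- j * `|xi.1|).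
    have c0 : 0 <= 2 ^- j :> R by rewrite invr_ge0 exprn_ge0.
    apply: (le_trans (G _)); rewrite ler_pM2l// ge_min /= normrM (ger0_norm c0).
    by rewrite lexx orbT.
  apply: (le_trans (ler_pM (normc_ge0 _) (normc_ge0 _) g1 g2)).
  by rewrite le_eqVlt; apply/orP; left; apply/eqP; ring.
apply: (@le_lt_trans _ _ ((C ^+ 2 * `|xi.1| * 2)%:E)); last exact: ltry.
apply: lime_le.
  by apply: is_cvg_nneseries => j _ _; rewrite lee_fin sqr_ge0.
apply: nearW => J; rewrite sumEFin lee_fin.
apply: (@le_trans _ _ (\sum_(n0 <= j < J) (C ^+ 2 * `|xi.1|) * 2 ^- j)).
  by apply: ler_sum => j _; exact: T.
rewrite -mulr_sumr ler_wpM2l ?geometric_half_le//.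
by rewrite mulr_ge0// sqr_ge0.
Qed.

End ShearletGeometry.

(** * Detection of the support and rotation *)

Section RampIntegrable.
Context {R : realType}.

Lemma measurable_ramp (q : R) n : measurable_fun setT (ramp q n).
Proof. by apply: measurable_funM => //; exact: measurable_trapezoid. Qed.

Lemma integrable_ramp (q a : R) n : 0 < q ->
  (@lebesgue_measure R).-integrable setT (EFin \o (fun t => ramp q n (t - a))).
Proof.
move=> q0.
have i0 : (@lebesgue_measure R).-integrable setT (EFin \o ramp q n).
  apply: (@le_integrable _ _ _ (@lebesgue_measure R) _ measurableT _
    (EFin \o (\1_`[- q, q]%classic : R -> R))) => //.
  - by apply/measurable_EFinP; exact: measurable_ramp.
  - move=> t _; rewrite /= lee_fin.
    have /andP[r0 r1] := ramp_le q n t q0.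
    have [tq|qt] := leP `|t| q.
      rewrite indicE mem_set ?normr1 ?ger0_norm//.
      by rewrite /= in_itv /= -ler_norml.
    by rewrite ramp_out ?normr0// ltW.
  - exact: integrable_indic_itv.
have := integrable_affine 1 (- a) (ramp q n) ltr01 i0.
by under eq_fun do rewrite mul1r.
Qed.

Definition plane_ramp (q a q' a' : R) (n : nat) (x : plane R) : R :=
  ramp q n (x.1 - a) * ramp q' n (x.2 - a').

Lemma integrable_plane_ramp q a q' a' n : 0 < q -> 0 < q' ->
  (leb2 R).-integrable setT (EFin \o plane_ramp q a q' a' n).
Proof.
move=> q0 q0'.
exact: (integrable_tensor (@lebesgue_measure R) (@lebesgue_measure R) _ _
  (integrable_ramp q a n q0) (integrable_ramp q' a' n q0')).
Qed.

Lemma plane_ramp_le1 q a q' a' n x : 0 < q -> 0 < q' ->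
  0 <= plane_ramp q a q' a' n x <= 1.
Proof.
move=> q0 q0'.
have /andP[r0 r1] := ramp_le q n (x.1 - a) q0.
have /andP[s0 s1] := ramp_le q' n (x.2 - a') q0'.
by rewrite mulr_ge0//=; exact: mulr_ile1.
Qed.

Lemma Lfun2_integrable_rect (f : plane R -> R) u v u' v' :
  f \in Lfun (leb2 R) 2%:E -> (leb2 R).-integrable (rect u v u' v') (EFin \o f).
Proof.
move=> f2; have mD := @measurable_rect R u v u' v'.
have fin : (leb2 R (rect u v u' v') < +oo)%E.
  rewrite [X in (X < _)%E](product_measure1E lebesgue_measure lebesgue_measure)//.
  have fI (w z : R) : (lebesgue_measure (`]w, z[%classic : set R) < +oo)%E.
    by rewrite lebesgue_measure_itv; case: ifP => _; rewrite ?ltry// -EFinD ltry.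
  by rewrite lte_mul_pinfty// ?ge0_fin_numE//; exact: fI.
have /Lfun1_integrable := Lfun2_mul_Lfun1 f2 (Lfun2_indic (leb2 R) _ mD fin).
rewrite [X in _ -> X]integrable_mkcond//; apply: eq_integrable => // x _ /=.
by rewrite patchE indicE; case: ifP => _; rewrite ?mulr1 ?mulr0.
Qed.

(** The Fourier transform of a ramp spectrum is a positive multiple of a product
    of ramps, so the real and imaginary parts of [f] integrate to zero against
    all products of ramps that avoid the box. *)
Lemma box_supported_of_ramps (M : R) (f : plane R -> R[i]) : 0 <= M ->
  cLp (leb2 R) 2%:E f ->
  (forall q a q' a' n, 0 < q -> 0 < q' ->
    M + q <= `|a| \/ M + q' <= `|a'| ->
    cintegral (leb2 R) (fun x => f x * fourier2 (ramp_spectrum q a q' a' n) x) = 0) ->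
  box_supported M f.
Proof.
move=> M0 [rf jf] ortho.
have part (u : plane R -> R) (pr : R[i] -> R) :
    (forall x (t : R), pr (f x * t%:C) = u x * t) ->
    (forall w, pr (cintegral (leb2 R) w) = \int[leb2 R]_x pr (w x)) -> pr 0 = 0 ->
    u \in Lfun (leb2 R) 2%:E -> {ae leb2 R, forall x, ~ box M x -> u x = 0}.
  move=> prE prI pr0 u2.
  have mu_ : measurable_fun setT u by have := sub_Lfun_mfun u2; rewrite inE.
  apply: ae_off_box => //.
    by move=> *; exact: Lfun2_integrable_rect.
  move=> q q' n a a' q0 q0' off.
  have [c c0 cE] := fourier2_ramp_spectrum q a q' a' n q0 q0'.
  have := congr1 pr (ortho q a q' a' n q0 q0' off); rewrite pr0 prI.
  under eq_Rintegral do rewrite cE prE mulrCA.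
  rewrite RintegralZl//.
    by move=> /eqP; rewrite mulf_eq0 (gt_eqF c0) => /eqP.
  apply/Lfun1_integrable; apply: (Lfun2_mul_Lfun1 u2).
  apply: (Lfun2_bounded (leb2 R) _ 1); first exact: integrable_plane_ramp.
  by move=> x; have /andP[r0 r1] := plane_ramp_le1 q a q' a' n x q0 q0'; rewrite ger0_norm.
have hr := part _ (@complex.Re R) (fun x t => _) (fun w => erefl) erefl rf.
have hj := part _ (@complex.Im R) (fun x t => _) (fun w => erefl) erefl jf.
apply: filterS2 (hr _) (hj _) => [x h1 h2 nb||].
- by apply: complex_eq; [exact: h1|exact: h2].
- by move=> x t; rewrite ReM /= mulr0 subr0.
- by move=> x t; rewrite ImM /= mulr0 add0r.
Qed.

End RampIntegrable.

Section Rotation.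
Context {R : realType}.
Let leb := @lebesgue_measure R.

(** Reflecting the inner variable of the iterated integral of the indicator
    turns it into the iterated integral taken in the other order. *)
Lemma leb2_rot90 (N : set (plane R)) : measurable N -> leb2 R N = 0%E ->
  measurable ((fun z : plane R => (- z.2, z.1) : plane R) @^-1` N) /\
  leb2 R ((fun z : plane R => (- z.2, z.1) : plane R) @^-1` N) = 0%E.
Proof.
move=> mN N0; set rot := fun z : plane R => (- z.2, z.1) : plane R.
have mrot : measurable_fun setT rot.
  apply: measurable_fun_plane => /=; last exact: measurable_fst.
  by apply: (measurableT_comp (@oppr_measurable R setT)).
have mP : measurable (rot @^-1` N).
  by rewrite -[X in measurable X]setTI; exact: mrot.
split=> //.
have mI : measurable_fun setT (EFin \o (\1_N : plane R -> R)).
  by apply/measurable_EFinP; exact: measurable_indic.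
transitivity (\int[leb2 R]_z ((EFin \o (\1_N : plane R -> R)) (rot z)))%E.
  by rewrite -[X in leb2 R X]setIT -(integral_indic (leb2 R) measurableT).
rewrite [LHS](@fubini_tonelli1 _ _ _ _ _ leb leb)//; last 2 first.
- exact: (measurableT_comp mI mrot).
- by move=> z; rewrite lee_fin.
transitivity (\int[leb]_y \int[leb]_x (EFin \o (\1_N : plane R -> R)) (x, y))%E.
  apply: eq_integral => y _.
  rewrite [RHS](esym (ge0_integral_opp (fun x => (EFin \o (\1_N : plane R -> R)) (x, y)) _ _))//.
    exact: (measurableT_comp mI (pair2_measurable y)).
  by move=> x; rewrite lee_fin.
rewrite -(@fubini_tonelli2 _ _ _ _ _ leb leb (EFin \o (\1_N : plane R -> R)))//.
  rewrite -N0 -[X in _ = leb2 R X]setIT -(integral_indic (leb2 R) measurableT)//.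
by move=> z; rewrite lee_fin.
Qed.

Lemma box_supported_rot90 (M : R) (f : plane R -> R[i]) :
  box_supported M f -> box_supported M (f \o mxact rot90).
Proof.
move=> [N [mN N0 fN]].
have [mP P0] := leb2_rot90 N mN N0.
exists ((fun z : plane R => (- z.2, z.1) : plane R) @^-1` N); split => //.
move=> z /= nz; apply: fN => /= h; apply: nz => nb.
have E : mxact rot90 z = (- z.2, z.1).
  by rewrite /rot90 mxact22 !mul0r add0r addr0 mulN1r mul1r.
rewrite E; apply: h => -[/= h1 h2]; apply: nb; split => //.
by rewrite -normrN.
Qed.

End Rotation.

(** * Compact support of the shearlets *)

Section UnfilteredShape.
Context {R : realType}.
Variables phi1 psi1 : R -> R[i].

Lemma sheared_argument (j : nat) (s : R) (p : nat) (m : int * int) (x : R * R) :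
  mxact (scaling j *m shearing s) x - mxact (sampling p) (m.1%:~R, m.2%:~R) =
  (2 ^+ j * x.1 + 2 ^+ j * s * x.2 - m.1%:~R,
   2 ^+ j./2 * x.2 - 2 ^- p.-1 * m.2%:~R).
Proof.
rewrite /scaling /shearing /sampling mx22M !mxact22.
by congr pair => /=; ring.
Qed.

(** Scaling after shearing is an upper triangular matrix, so every unfiltered
    element is a tensor product of generators along two affine forms, the second
    of which depends on one coordinate only. *)
Lemma unfiltered_shape (lam : shearlet_index R) :
  exists (a b : R -> R[i]) (c : R[i]) (al be ga de ep : R),
  [/\ (a = phi1 \/ a = psi1), (b = phi1 \/ b = psi1), 0 < al /\ 0 < de &
      unfiltered phi1 psi1 lam =
      fun x => c * (a (line1 al be ga x) * b (line2 de ep x))].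
Proof.
have main (G : nat -> R * R -> R[i]) (u : R -> R[i]) j s m p :
    (u = phi1 \/ u = psi1) ->
    (forall x, G 0%N x = u x.1 * phi1 x.2) ->
    (forall q x, G q.+1 x =
      (2 `^ (q%:R / 2))%:C * (u x.1 * psi1 (2 ^+ q * x.2))) ->
    exists (a b : R -> R[i]) (c : R[i]) (al be ga de ep : R),
    [/\ (a = phi1 \/ a = psi1), (b = phi1 \/ b = psi1), 0 < al /\ 0 < de &
      sheared G j s m p = fun x => c * (a (line1 al be ga x) * b (line2 de ep x))].
  move=> uE G0 GS; case: p => [|q].
    exists u, phi1, (Num.sqrt `|\det (@scaling R j)|)%:C,
      (2 ^+ j), (2 ^+ j * s), (- m.1%:~R), (2 ^+ j./2), (- (2 ^- 0 * m.2%:~R)).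
    split=> //; first by left.
    by apply/funext => x; rewrite /sheared sheared_argument G0.
  exists u, psi1, ((Num.sqrt `|\det (@scaling R j)|)%:C * (2 `^ (q%:R / 2))%:C),
    (2 ^+ j), (2 ^+ j * s), (- m.1%:~R), (2 ^+ q * 2 ^+ j./2),
    (- (2 ^+ q * (2 ^- q * m.2%:~R))).
  split=> //; first by right.
  apply/funext => x; rewrite /sheared sheared_argument GS -[RHS]mulrA.
  congr (_ * (_ * (_ * psi1 _))).
  by rewrite /line2 /=; ring.
case: lam => [[[[n|n] s] m] p].
  by apply: (main (psi_gen phi1 psi1) psi1); [right| |].
by apply: (main (phi_gen phi1 psi1) phi1); [left| |].
Qed.

End UnfilteredShape.

Section CompactShearlets.
Context {R : realType}.
Variables (alpha beta : R) (phi1 psi1 : R -> R[i]) (g : R * R -> R[i]).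
Hypotheses (alpha1 : 1 <= alpha) (beta0 : 0 <= beta).
Hypotheses (phi1_L2 : cLp (leb1 R) 2%:E phi1) (psi1_L2 : cLp (leb1 R) 2%:E psi1).
Hypotheses (phi1_supp : compactly_supported1 phi1)
  (psi1_supp : compactly_supported1 psi1).
Hypotheses (g_L2 : cLp (leb2 R) 2%:E g) (g_supp : compactly_supported2 g).
Hypothesis g_decay : bounded_upto_const (cpartial2 0 (fourier2 g))
  (fun xi => Num.min 1 (`|xi.1| `^ alpha) /
             ((1 + `|xi.1|) `^ beta * (1 + `|xi.2|) `^ beta)).

Lemma generator_line (a : R -> R[i]) : a = phi1 \/ a = psi1 ->
  cintegrable (leb1 R) a /\
  exists K, {ae leb1 R, forall x, ~ `[- K, K]%classic x -> a x = 0}.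
Proof.
case=> ->.
  have [K phiK] := compactly_supported1_itv _ phi1_supp.
  by split; [exact: cLp2_itv_integrable phi1_L2 phiK|exists K].
have [K psiK] := compactly_supported1_itv _ psi1_supp.
by split; [exact: cLp2_itv_integrable psi1_L2 psiK|exists K].
Qed.

Lemma line_tensor_admissible (a b : R -> R[i]) (c : R[i]) (al be ga de ep : R) :
  a = phi1 \/ a = psi1 -> b = phi1 \/ b = psi1 -> 0 < al -> 0 < de ->
  let h := fun x : plane R => c * (a (line1 al be ga x) * b (line2 de ep x)) in
  cintegrable (leb2 R) h /\ exists K, box_supported K h.
Proof.
move=> /generator_line[ia [K aK]] /generator_line[ib [K' bK]] al0 de0 h.
have it := cintegrable_line_tensor al be ga de ep al0 de0 a b ia ib.
split.
  rewrite /h (_ : (fun _ => _) =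
    (fun x => (a (line1 al be ga x) * b (line2 de ep x)) * c)); last first.
    by apply/funext => x; rewrite mulrC.
  apply: (cintegrable_bounded (leb2 R) _ _ (normc c) it) => //.
  exact: cmeasurable_cst.
have [M HM] := box_supported_line_tensor al be ga de ep al0 de0 a b K K' aK bK.
by exists M; apply: filterS HM => x hx /hx; rewrite /h => ->; rewrite mulr0.
Qed.

Lemma unfiltered_admissible lam :
  cintegrable (leb2 R) (unfiltered phi1 psi1 lam) /\
  exists K, box_supported K (unfiltered phi1 psi1 lam).
Proof.
have [a [b [c [al [be [ga [de [ep [aE bE [al0 de0] ->]]]]]]]]] :=
  unfiltered_shape phi1 psi1 lam.
exact: line_tensor_admissible.
Qed.

(** The filter of a nonzero shear has no low-pass term; the zero function
    stands for it, so that both kinds of filter have the same form. *)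
Lemma lowpass_admissible (s : R) :
  let k := if s == 0 then phi_gen phi1 psi1 0 else fun=> 0 in
  cintegrable (leb2 R) k /\ exists K, box_supported K k.
Proof.
case: ifP => _ /=.
  have := line_tensor_admissible phi1 phi1 1 1 0 0 1 0
    (or_introl erefl) (or_introl erefl) ltr01 ltr01.
  rewrite /= (_ : (fun _ => _) = phi_gen phi1 psi1 0)//.
  apply/funext => x; rewrite /phi_gen /line1 /line2.
  by rewrite !mul1r mul0r !addr0.
split; first by split; apply: integrable0.
by exists 0; apply: aeW.
Qed.

Lemma filter_hatE (s : R) : filter_hat phi1 psi1 g s =
  full_filter (if s == 0 then phi_gen phi1 psi1 0 else fun=> 0) g (freq_map s)
    (if s == 0 then 0%N else shear_j0 s).
Proof.
apply/funext => xi; rewrite /filter_hat /full_filter /filter_term.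
case: eqVneq => [->|s0].
  by under eq_eseriesr => j _ do rewrite freq_map0E.
rewrite (_ : fourier2 (fun=> 0) xi = 0); last first.
  by rewrite fourier2E; under eq_cintegral do rewrite mul0r; exact: cintegral0.
rewrite normc0 expr0n add0r.
by under eq_eseriesr => j _ do rewrite freq_mapE.
Qed.

(** Each partial filter enlarges the box of the unfiltered element by twice the
    radius [r] that bounds the support of the low-pass generator and, uniformly
    in the scale, that of the dilated and sheared [g]. *)
Lemma psi0_box_supported lam f : is_psi0 phi1 psi1 g lam f ->
  exists M, box_supported M f.
Proof.
have [ih [K hK]] := unfiltered_admissible lam.
move: ih hK; case: lam => [[[j s] m] p]; rewrite /is_psi0 /is_filtered.
set h := unfiltered _ _ _ => ih hK; rewrite filter_hatE.
have [ik [r1 kr]] := lowpass_admissible s.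
set k := (if s == 0 then _ else _) in ik kr *; set n0 := (if s == 0 then _ else _).
have [rho grho] := compactly_supported2_box g g_supp.
have ig := cLp2_box_integrable rho g g_L2 grho.
(* One radius for the low-pass term and for all scales of [g]. *)
pose r := Num.max r1 ((1 + `|s|) * rho).
have kr' : box_supported r k.
  apply: filterS kr => x kx nb; apply: kx => bx; apply: nb.
  by apply: box_mono bx; rewrite le_max lexx.
have bd i y : box rho y -> box r (freq_adj s i y).
  by move=> /(freq_adj_box s rho i); apply: box_mono; rewrite le_max lexx orbT.
have gsum xi := filter_sum_lty alpha beta g s n0 xi alpha1 beta0 g_decay.
move=> fF.
(* The maximum keeps the radius [K' + r + r] of the final box nonnegative. *)
pose K' := Num.max K (0 - r - r).
have hK' : box_supported K' h.
  apply: filterS hK => x hx nb; apply: hx => bx; apply: nb.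
  by apply: box_mono bx; rewrite le_max lexx.
exists (K' + r + r); apply: box_supported_of_ramps.
- have : 0 - r - r <= K' by rewrite le_max lexx orbT.
  lra.
- exact: fF.1.
move=> q a q' a' n q0 q0' off.
have [C hC] := @ramp_spectrum_bounded R q a q' a' n.
have [c c0 cE] := fourier2_ramp_spectrum q a q' a' n q0 q0'.
have iphi := @cintegrable_ramp_spectrum R q a q' a' n.
have [C' hC'] := fourier2_bounded _ iphi.
apply: (fourier_L2_orthogonal f _ _ C C' fF) => //.
- exact: (cmeasurable_filtered k g (freq_map s) n0 ik ig (measurable_freq_map s) gsum h ih).
- apply: (cintegrable_le (leb2 R) _ (fun x => c * plane_ramp q a q' a' n x)).
  + exact: cmeasurable_fourier2 (cintegrable_measurable _ _ iphi).
  + exact: (integrableZl measurableT c (integrable_plane_ramp q a q' a' n q0 q0')).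
  + move=> x; rewrite cE normc_realC ger0_norm//.
    have /andP[t0 t1] := plane_ramp_le1 q a q' a' n x q0 q0'.
    exact: mulr_ge0 (ltW c0) t0.
- move=> iF.
  apply: (filter_pairing_eq0 k g (freq_map s) (freq_adj s) rho r n0) => //.
  + exact: measurable_freq_map.
  + exact: measurable_freq_adj.
  + exact: freq_adjP.
  + exact: hK'.
  + exact: annihilator_ramp_spectrum.
Qed.

End CompactShearlets.

Theorem lemma2p6 (R : realType) (rho alpha beta : R)
    (phi1 psi1 : R -> R[i]) (g : R * R -> R[i])
    (Hrho : 0 < rho < 2 / 13)
    (Halpha : 6 / rho + 1 <= alpha)
    (Hbeta : alpha + 1 < beta)
    (phi1_L2 : cLp (leb1 R) 2%:E phi1)
    (psi1_L2 : cLp (leb1 R) 2%:E psi1)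
    (phi1_supp : compactly_supported1 phi1)
    (psi1_supp : compactly_supported1 psi1)
    (phi1_inf :
       0 < inf [set normc (fourier1 phi1 xi) | xi in `[- 2^-1, 2^-1]])
    (psi1_decay : forall l : nat, (l <= 1)%N ->
       bounded_upto_const (cderiv l (fourier1 psi1))
         (fun xi => Num.min 1 (`|xi| `^ alpha) / (1 + `|xi|) `^ beta))
    (phi1_decay : forall l : nat, (l <= 1)%N ->
       bounded_upto_const (cderiv l (fourier1 phi1))
         (fun xi => 1 / (1 + `|xi|) `^ beta))
    (wavelet_basis :
       orthonormal_basis (leb1 R) (wavelet_family phi1 psi1))
    (g_L2 : cLp (leb2 R) 2%:E g)
    (g_supp : compactly_supported2 g)
    (g_inf : 0 < inf [set normc (fourier2 g xi) | xi in Omega_g])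
    (g_decay : forall l : nat, (l <= 1)%N ->
       bounded_upto_const (cpartial2 l (fourier2 g))
         (fun xi => Num.min 1 (`|xi.1| `^ alpha) /
                    ((1 + `|xi.1|) `^ beta * (1 + `|xi.2|) `^ beta))) :
  forall f : R * R -> R[i],
    shearlet_system phi1 psi1 g f -> compactly_supported2 f.
Proof.
have /andP[rho0 _] := Hrho.
have alpha1 : 1 <= alpha.
  by apply: le_trans Halpha; rewrite lerDr divr_ge0// ltW.
have beta0 : 0 <= beta by lra.
have psi0_box := psi0_box_supported alpha beta phi1 psi1 g alpha1 beta0
  phi1_L2 psi1_L2 phi1_supp psi1_supp g_L2 g_supp (g_decay 0%N isT).
move=> f [s [lam [[] [_ _ psif]]]].
  have [f0 /psi0_box[M f0M] ->] := psif.
  exact: box_compactly_supported2 M _ (box_supported_rot90 M f0 f0M).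
have [M fM] := psi0_box _ _ psif.
exact: box_compactly_supported2 M f fM.
Qed.
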